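(* Given an instance $(\sigma,\pi)$ of the \textsc{Permutation Pattern} problem and a $t$-monotone partition $\Pi$ of $\pi$, one can decide whether $\sigma$ is a subpattern of $\pi$ in time $O(t^{\ell}\ell^2 n^2)$ and polynomial space, where $\ell=|\sigma|$ and $n=|\pi|$.
   Context: A permutation is a pair $\pi=(S,P)$, $S$ a finite set of positive integers, $P:S\to\mathbb{N}^2$ injective with $P(S)$ in general position; reduced permutations of length $n$ have $S=[n]$ and $P(S)\subseteq[n]\times[n]$. For $\alpha\in\{1,2\}$, $p<^{\pi}_{\alpha}p'$ means the $\alpha$-th coordinate of $P(p)$ is smaller than that of $P(p')$. An embedding of $\sigma$ into $\pi$ is $\phi:S(\sigma)\to S(\pi)$ with $p<^{\sigma}_{\alpha}p'\iff\phi(p)<^{\pi}_{\alpha}\phi(p')$ for all $p,p'$ and $\alpha$; $\sigma$ is a subpattern of $\pi$ if one exists. \textsc{Permutation Pattern}: given reduced permutations $\sigma,\pi$, decide whether $\sigma$ is a subpattern of $\pi$. For $S'\subseteq S$, $\pi|S'=(S',P|_{S'})$. $\pi$ is increasing (resp. decreasing) if for all $p,p'\in S$, $p<^\pi_1p'$ iff $p<^\pi_2p'$ (resp. iff $p'<^\pi_2p$); monotone if increasing or decreasing. A $t$-monotone partition of $\pi$ is a partition $(S_1,\dots,S_t)$ of $S(\pi)$ such that each $\pi|S_i$ is monotone. *)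

(* Defs.v *)
From mathcomp Require Import all_boot finmap.

Set Implicit Arguments.
Unset Strict Implicit.
Unset Printing Implicit Defensive.

Local Open Scope fset_scope.

(** * Permutations as labelled point sets *)

(* Only the values of [pt] on [supp] are meaningful: every notion below
   quantifies over labels in [supp]. *)
Record lpoints := LPoints { supp : {fset nat}; pt : nat -> nat * nat }.

Inductive axis := Axis1 | Axis2.

Definition coord (a : axis) (q : nat * nat) : nat :=
  match a with Axis1 => q.1 | Axis2 => q.2 end.

Definition general_position (pi : lpoints) : Prop :=
  forall a, {in supp pi &, forall p p', p != p' ->
    coord a (pt pi p) != coord a (pt pi p')}.

Definition is_permutation (pi : lpoints) : Prop :=
  [/\ {in supp pi, forall p, 0 < p},
      {in supp pi &, injective (pt pi)} &
      general_position pi].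

Definition len (pi : lpoints) : nat := #|` supp pi|.

Definition reduced (pi : lpoints) : Prop :=
  [/\ is_permutation pi,
      supp pi = [fset p in iota 1 (len pi)] &
      {in supp pi, forall p a, 0 < coord a (pt pi p) <= len pi}].

Definition lt_on (pi : lpoints) (a : axis) (p p' : nat) : bool :=
  coord a (pt pi p) < coord a (pt pi p').

Definition embedding (sigma pi : lpoints) (phi : nat -> nat) : Prop :=
  {in supp sigma, forall p, phi p \in supp pi} /\
  forall a, {in supp sigma &, forall p p',
    lt_on sigma a p p' <-> lt_on pi a (phi p) (phi p')}.

Definition subpattern (sigma pi : lpoints) : Prop :=
  exists phi, embedding sigma pi phi.

Definition restrict (pi : lpoints) (A : {fset nat}) : lpoints :=
  LPoints A (pt pi).

Definition increasing (pi : lpoints) : Prop :=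
  {in supp pi &, forall p p', lt_on pi Axis1 p p' <-> lt_on pi Axis2 p p'}.

Definition decreasing (pi : lpoints) : Prop :=
  {in supp pi &, forall p p', lt_on pi Axis1 p p' <-> lt_on pi Axis2 p' p}.

Definition monotone (pi : lpoints) : Prop := increasing pi \/ decreasing pi.

(* Classes are allowed to be empty. *)
Definition monotone_partition (t : nat) (pi : lpoints)
    (Pi : t.-tuple {fset nat}) : Prop :=
  [/\ forall p, p \in supp pi <-> exists i, p \in tnth Pi i,
      forall i j, i != j -> [disjoint tnth Pi i & tnth Pi j] &
      forall i, monotone (restrict pi (tnth Pi i))].

(** * A word RAM

  A machine with [cells] memory cells, each of them, like each register,
  holding a word of value less than [word].  Programs are written in a
  structured language; a program uses a fixed finite number of registers.
  A computation that leaves the word range (even in an intermediate result)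
  or addresses a cell outside of the memory is stuck: it has no [exec]
  derivation. *)

Inductive binop := Add | Sub | Mul | Lt | Eq.

Inductive expr :=
| Const of nat
| Reg of nat
| Fetch of expr
| Op of binop & expr & expr.

Inductive cmd :=
| Skip
| Assign of nat & expr
| Store of expr & expr
| Seq of cmd & cmd
| If of expr & cmd & cmd
| While of expr & cmd.

Record state := State { reg : nat -> nat; mem : nat -> nat }.

Definition upd (f : nat -> nat) (i v : nat) : nat -> nat :=
  fun j => if j == i then v else f j.

Definition set_reg (s : state) r v := State (upd (reg s) r v) (mem s).
Definition set_mem (s : state) i v := State (reg s) (upd (mem s) i v).

Definition binop_fun (o : binop) : nat -> nat -> nat :=
  match o with
  | Add => addn
  | Sub => subn
  | Mul => muln
  | Lt => fun x y => nat_of_bool (x < y)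
  | Eq => fun x y => nat_of_bool (x == y)
  end.

Definition guard_lt (bound v : nat) : option nat :=
  if v < bound then Some v else None.

Fixpoint eval (word cells : nat) (s : state) (e : expr) : option nat :=
  match e with
  | Const v => guard_lt word v
  | Reg r => guard_lt word (reg s r)
  | Fetch e1 =>
      obind (fun i => guard_lt word (mem s i))
        (obind (guard_lt cells) (eval word cells s e1))
  | Op o e1 e2 =>
      obind (fun v1 =>
        obind (fun v2 => guard_lt word (binop_fun o v1 v2))
          (eval word cells s e2))
        (eval word cells s e1)
  end.

Fixpoint cost (e : expr) : nat :=
  match e with
  | Const _ | Reg _ => 1
  | Fetch e1 => (cost e1).+1
  | Op _ e1 e2 => (cost e1 + cost e2).+1
  end.

(* [exec word cells c s T s']: started in [s], [c] halts in [s'] after time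
   [T]; every node of an evaluated expression and every executed assignment,
   store, skip and test costs one unit. *)
Inductive exec (word cells : nat) : cmd -> state -> nat -> state -> Prop :=
| ExecSkip s : exec word cells Skip s 1 s
| ExecAssign s r e v :
    eval word cells s e = Some v ->
    exec word cells (Assign r e) s (cost e).+1 (set_reg s r v)
| ExecStore s e1 e2 i v :
    eval word cells s e1 = Some i -> i < cells ->
    eval word cells s e2 = Some v ->
    exec word cells (Store e1 e2) s (cost e1 + cost e2).+1 (set_mem s i v)
| ExecSeq c1 c2 s T1 s1 T2 s2 :
    exec word cells c1 s T1 s1 -> exec word cells c2 s1 T2 s2 ->
    exec word cells (Seq c1 c2) s (T1 + T2) s2
| ExecIf e c1 c2 s v T s' :
    eval word cells s e = Some v ->
    exec word cells (if v != 0 then c1 else c2) s T s' ->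
    exec word cells (If e c1 c2) s (cost e + T).+1 s'
| ExecWhileStop e c s :
    eval word cells s e = Some 0 ->
    exec word cells (While e c) s (cost e).+1 s
| ExecWhileStep e c s v T1 s1 T2 s2 :
    eval word cells s e = Some v -> v != 0 ->
    exec word cells c s T1 s1 ->
    exec word cells (While e c) s1 T2 s2 ->
    exec word cells (While e c) s (cost e + T1 + T2).+1 s2.

Lemma exec_det word cells c s T1 s1 T2 s2 :
  exec word cells c s T1 s1 -> exec word cells c s T2 s2 ->
  T1 = T2 /\ s1 = s2.
Proof.
move=> H; elim: H T2 s2 => {c s T1 s1}.
- by move=> s T2 s2 H; inversion H.
- by move=> s r e v He T2 s2 H; inversion H; split=> //; congruence.
- by move=> s e1 e2 i v He1 _ He2 T2 s2 H; inversion H; split=> //; congruence.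
- move=> c1 c2 s T1 s1 T2 s2 _ IH1 _ IH2 T3 s3 H.
  inversion H as [| | |? ? ? ? ? ? ? H1 H2| | |]; subst.
  by have [? ?] := IH1 _ _ H1; subst; have [-> ->] := IH2 _ _ H2.
- move=> e c1 c2 s v T s' He _ IH T2 s2 H.
  inversion H as [| | | |? ? ? ? w ? ? Hw H1| |]; subst.
  by move: Hw H1; rewrite He => -[<-] /IH [-> ->].
- move=> e c s He T2 s2 H.
  inversion H as [| | | | | |? ? ? w ? ? ? ? Hw nz]; subst; first by [].
  by move: Hw nz; rewrite He => -[<-].
- move=> e c s v T1 s1 T2 s2 He nz _ IH1 _ IH2 T3 s3 H.
  inversion H as [| | | | |? ? ? Hw|? ? ? w ? ? ? ? Hw _ H1 H2]; subst.
    by move: Hw nz; rewrite He => -[->].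
  by have [? ?] := IH1 _ _ H1; subst; have [-> ->] := IH2 _ _ H2.
Qed.

(* The input occupies the first memory cells; the answer is read in
   register 0. *)
Definition init (input : seq nat) : state :=
  State (fun _ => 0) (fun i => nth 0 input i).

Definition answers (word cells : nat) (prog : cmd) (input : seq nat)
    (T : nat) (b : bool) : Prop :=
  exists2 s, exec word cells prog (init input) T s & reg s 0 = b.

(** * Encoding of instances *)

Definition encode_points (pi : lpoints) : seq nat :=
  flatten [seq [:: (pt pi p).1; (pt pi p).2] | p <- iota 1 (len pi)].

Definition encode_class (A : {fset nat}) : seq nat :=
  #|` A| :: sort leq (enum_fset A).

Definition encode (sigma pi : lpoints) (Pi : seq {fset nat}) : seq nat :=
  [:: len sigma; len pi; size Pi] ++
  encode_points sigma ++ encode_points pi ++ flatten (map encode_class Pi).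

(* Main.v *)
Require Import Defs.
From mathcomp Require Import all_boot finmap.
From mathcomp Require Import zify.

(* Fix an assignment [G] of a class of [pi] to every element of [sigma].  An
   embedding compatible with [G] only has to respect the pairs that are
   consecutive in one of the two orders of [sigma], which gives O(l) binary
   constraints.  Search for it with a box per element, shrunk by unit steps
   whenever one of its four sides is refuted; as each shrinking step only
   concerns two elements, a stack of suspects makes a full propagation cost
   O(l n).  Because the classes are monotone, clamping a solution to any
   consistent family of boxes is again a solution (a median argument): an
   element can be fixed to any point for which propagation succeeds, without
   backtracking.  This is at most l n propagations per assignment, hence
   O(l^2 n^2), and the t^l assignments are enumerated by an odometer. *)

Set Implicit Arguments.
Unset Strict Implicit.
Unset Printing Implicit Defensive.

(** * Bound propagation and its completeness *)

(** Clamping a number to an interval takes the median of the number and the two ends, which is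
    strictly increasing when all three increase; this keeps the constraints between consecutive
    elements. The obstacle is that an element is sent to a point, whose two coordinates cannot be
    clamped independently. Hence the tests demand more than order: the point lying on each side of a
    box must belong to the prescribed class and to the box. In a monotone class such extremal points
    coincide in pairs, so that one and the same point realizes both clamped coordinates. Clamping
    asks only for consistent boxes, not for boxes nested in earlier ones. A trial may therefore put
    an element at a point outside its accepted box without losing solvability. The linear cost of a
    propagation is amortized: a raise uses up one of at most [4 * l * n] units, and pushes at most
    one suspect. Values stay below a fixed power of the input size, which serves as bound for words
    and cells alike. *)

(* Directions 0, 1, 2, 3 are: left to right, right to left, bottom to top, top
   to bottom.  The side [d] of a box is a lower bound on coordinate [d], so the
   upper bounds are the lower bounds of the opposite direction. *)
Definition opp d := match d with 0 => 1 | 1 => 0 | 2 => 3 | _ => 2 end.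

(* [pr d i] is the predecessor of [i] in direction [d], or 0 if there is none;
   [cr d q] is the coordinate of the point [q], and [point d] its inverse. *)
Section Search.
Variables (l n : nat) (pr cr point : nat -> nat -> nat) (C G : nat -> nat).
Hypothesis cr_range : forall d q, d < 4 -> 0 < q <= n -> 0 < cr d q <= n.
Hypothesis point_range : forall d b, d < 4 -> 0 < b <= n -> 0 < point d b <= n.
Hypothesis pointK : forall d b, d < 4 -> 0 < b <= n -> cr d (point d b) = b.
Hypothesis crK : forall d q, d < 4 -> 0 < q <= n -> point d (cr d q) = q.
Hypothesis cr_opp : forall d q, d < 4 -> 0 < q <= n -> cr (opp d) q + cr d q = n.+1.
Hypothesis pr_range : forall d i, d < 4 -> 0 < i <= l -> pr d i <= l.
Hypothesis pr_opp : forall d i, d < 4 -> 0 < i <= l -> 0 < pr d i -> pr (opp d) (pr d i) = i.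

Definition same_class_monotone := forall c,
  (forall q q', 0 < q <= n -> 0 < q' <= n -> C q = c -> C q' = c ->
     (cr 0 q < cr 0 q') = (cr 2 q < cr 2 q')) \/
  (forall q q', 0 < q <= n -> 0 < q' <= n -> C q = c -> C q' = c ->
     (cr 0 q < cr 0 q') = (cr 2 q' < cr 2 q)).

(** Exactly one point of [pi] has [d]-coordinate [B d i]. The side is refuted when that point cannot
    be the image of [i]: not beyond the predecessor, wrong class, or outside the box. *)
Definition fires (B : nat -> nat -> nat) d i :=
  [|| B d i <= B d (pr d i), C (point d (B d i)) != G i
    | has (fun e => cr e (point d (B d i)) < B e i) (iota 0 4)].

Definition solution (s : nat -> nat) := forall i, 0 < i <= l ->
  [/\ 0 < s i <= n, C (s i) = G i &
      forall d, d < 4 -> 0 < pr d i -> cr d (s (pr d i)) < cr d (s i)].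

Definition in_box (B : nat -> nat -> nat) (s : nat -> nat) :=
  forall d i, d < 4 -> 0 < i <= l -> B d i <= cr d (s i).

(** Index 0 stands for a missing predecessor. Its side 0 lies below every genuine side, so the order
    test then never fires. *)
Definition box_ok (B : nat -> nat -> nat) :=
  forall d, d < 4 -> B d 0 = 0 /\ forall i, 0 < i <= l -> 0 < B d i <= n.

Definition consistent B :=
  box_ok B /\ forall d i, d < 4 -> 0 < i <= l -> ~~ fires B d i.

(** A solution touching the side would send [i] to the only point on it, and each of the three tests
    excludes that point. *)
Lemma fires_sound B s d i : box_ok B -> solution s -> in_box B s ->
  d < 4 -> 0 < i <= l -> fires B d i -> B d i < cr d (s i).
Proof.
move=> hB hs hb hd hi hf.
have := hb d i hd hi; rewrite leq_eqVlt => /orP [/eqP E|//].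
have [si sc sp] := hs i hi.
move: hf; rewrite /fires E crK // sc eqxx orFb.
have -> : has (fun e => cr e (s i) < B e i) (iota 0 4) = false.
  by apply/hasP => -[e]; rewrite mem_iota => /andP [_ he]; have := hb e i he hi; lia.
rewrite orbF => h; have [h0|h0] := posnP (pr d i).
  have [hB0 _] := hB d hd; have [hB1 _] := hB d hd.
  by move: h; rewrite h0 hB0; have := cr_range hd si; lia.
have hj : 0 < pr d i <= l by rewrite h0 pr_range.
by have := sp d hd h0; have := hb d _ hd hj; lia.
Qed.

Definition raise (B : nat -> nat -> nat) d i d' i' :=
  if (d' == d) && (i' == i) then (B d i).+1 else B d' i'.

(* Raising the side [d] of [i] can only refute a side of [i] itself or of its
   successor in direction [d]: these are the suspects to put on the stack. *)
Lemma raise_fires B d i d' j : d < 4 -> d' < 4 -> 0 < i <= l -> 0 < j <= l ->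
  j != i -> j != pr (opp d) i -> fires (raise B d i) d' j = fires B d' j.
Proof.
move=> hd hd' hi hj ji jp; rewrite /fires /raise (negPf ji) !andbF.
congr [|| _, _ | _].
(* The raised value is read at [pr d j] only if [pr d j = i], and then [j] is the neighbour of [i]
   in the opposite direction. *)
- case: ifP => // /andP [/eqP E /eqP E']; subst d'.
  have := pr_opp hd hj; rewrite E' => /(_ _) E2.
  by move: jp; rewrite E2 ?eqxx //; lia.
- by apply: eq_has => e; rewrite andbF.
Qed.

(** * Clamping a solution to consistent boxes *)

Section Clamp.
Variables (B : nat -> nat -> nat) (s : nat -> nat).
Hypothesis mono : same_class_monotone.
Hypothesis hB : consistent B.
Hypothesis hs : solution s.

(* In a class, the points of a box form an interval whose ends are the corners
   of the box; this is where monotonicity makes clamping in the first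
   coordinate agree with clamping in the second. *)
Definition clamp i :=
  if cr 0 (s i) < B 0 i then point 0 (B 0 i)
  else if cr 1 (s i) < B 1 i then point 1 (B 1 i) else s i.

(* [hi'] is an upper bound read in the opposite direction. *)
Definition clampv (lo hi' v : nat) := maxn lo (minn v (n.+1 - hi')).

Lemma corner d i : d < 4 -> 0 < i <= l ->
  [/\ 0 < point d (B d i) <= n, C (point d (B d i)) = G i,
      cr d (point d (B d i)) = B d i & forall e, e < 4 -> B e i <= cr e (point d (B d i))].
Proof.
move=> hd hi; have [hB1 hB2] := hB; have [_ /(_ i hi) hb] := hB1 d hd.
have := hB2 d i hd hi; rewrite /fires 2!negb_or negbK => /and3P [_ /eqP hc].
rewrite -all_predC => /allP hh.
split=> //; [exact: point_range|exact: pointK|].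
by move=> e he; move: (hh e) => /=; rewrite !inE -leqNgt; apply; case: e he => [|[|[|[|]]]].
Qed.

(** [clamp] looks at horizontal sides only; the last conclusion says that it clamps vertically as
    well. *)
Lemma clampP i : 0 < i <= l ->
  [/\ 0 < clamp i <= n, C (clamp i) = G i,
      cr 0 (clamp i) = clampv (B 0 i) (B 1 i) (cr 0 (s i)) &
      cr 2 (clamp i) = clampv (B 2 i) (B 3 i) (cr 2 (s i))].
Proof.
move=> hi; have [s1 s2 _] := hs hi.
have [p0 c0 e0 h0] := @corner 0 i isT hi.
have [p1 c1 e1 h1] := @corner 1 i isT hi.
have [p2 c2 e2 h2] := @corner 2 i isT hi.
have [p3 c3 e3 h3] := @corner 3 i isT hi.
have [u0 v0] := (@cr_opp 0 _ isT p0, @cr_opp 2 _ isT p0).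
have [u1 v1] := (@cr_opp 0 _ isT p1, @cr_opp 2 _ isT p1).
have [u2 v2] := (@cr_opp 0 _ isT p2, @cr_opp 2 _ isT p2).
have [u3 v3] := (@cr_opp 0 _ isT p3, @cr_opp 2 _ isT p3).
have [us vs] := (@cr_opp 0 _ isT s1, @cr_opp 2 _ isT s1).
simpl in u0, v0, u1, v1, u2, v2, u3, v3, us, vs.
have [[h01 h02] h03] := (h0 1 isT, h0 2 isT, h0 3 isT).
have [[h10 h12] h13] := (h1 0 isT, h1 2 isT, h1 3 isT).
have [[h20 h21] h23] := (h2 0 isT, h2 1 isT, h2 3 isT).
have [[h30 h31] h32] := (h3 0 isT, h3 1 isT, h3 2 isT).
have cl : clamp i = point 0 (B 0 i) \/ clamp i = point 1 (B 1 i) \/ clamp i = s i.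
  by rewrite /clamp; case: ifP => _; [left|right; case: ifP => _; [left|right]].
have rc : 0 < clamp i <= n /\ C (clamp i) = G i.
  by case: cl => [->|[->|->]].
have E x y d : d < 4 -> 0 < x <= n -> 0 < y <= n -> cr d x = cr d y -> x = y.
  by move=> hd hx hy h; rewrite -(crK hd hx) h crK.
(* Both tests of [clamp] become comparisons of points of one class, which monotonicity turns into
   vertical comparisons. *)
have c0' : (cr 0 (s i) < B 0 i) = (cr 0 (s i) < cr 0 (point 0 (B 0 i))) by rewrite e0.
have c1' : (cr 1 (s i) < B 1 i) = (cr 0 (point 1 (B 1 i)) < cr 0 (s i)).
  by clear -us u1 e1; lia.
split; [by case: rc|by case: rc|..].
- rewrite /clamp /clampv; clear -e0 e1 h01 h10 u0 u1 us.
  by case: ifP => k0; [|case: ifP => k1]; lia.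
have [m|m] := mono (G i).
(* Increasing class: the leftmost corner is the lowest and the rightmost the highest. *)
- have q02 : point 0 (B 0 i) = point 2 (B 2 i).
    apply: (E _ _ 0) => //; have := m _ _ p0 p2 c0 c2.
    by rewrite e0 e2; clear -h20 h02; lia.
  have q13 : point 1 (B 1 i) = point 3 (B 3 i).
    apply: (E _ _ 1) => //; have := m _ _ p3 p1 c3 c1.
    by clear -h31 h13 u1 u3 v1 v3 e1 e3; lia.
  rewrite /clamp c0' c1' (m _ _ s1 p0 s2 c0) (m _ _ p1 s1 c1 s2) q02 q13 /clampv.
  rewrite e2; move: v3; rewrite e3 -q13; clear -vs h12 h02 h13 h23 v2 e2.
  by move=> ?; case: ifP => k0; [|case: ifP => k1]; lia.
(* Decreasing class: the leftmost corner is the highest and the rightmost the lowest. *)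
- have q03 : point 0 (B 0 i) = point 3 (B 3 i).
    apply: (E _ _ 0) => //; have := m _ _ p0 p3 c0 c3.
    by clear -h30 h03 v0 v3 e0 e3; lia.
  have q12 : point 1 (B 1 i) = point 2 (B 2 i).
    apply: (E _ _ 1) => //; have := m _ _ p2 p1 c2 c1.
    by clear -h21 h12 u1 u2 e1 e2; lia.
  rewrite /clamp c0' c1' (m _ _ s1 p0 s2 c0) (m _ _ p1 s1 c1 s2) q03 q12 /clampv.
  rewrite e2; clear -vs v3 e3 h23 h32 v2 e2.
  by case: ifP => k0; [|case: ifP => k1]; lia.
Qed.

(** All three arguments of the median increase strictly from the predecessor to [i]: the lower ends
    since side [d] of [i] does not fire, the upper ends since the opposite side of the predecessor
    does not, the values since [s] is a solution. *)
Lemma clampv_lt d i : d = 0 \/ d = 2 -> 0 < i <= l -> 0 < pr d i ->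
  clampv (B d (pr d i)) (B (opp d) (pr d i)) (cr d (s (pr d i))) <
  clampv (B d i) (B (opp d) i) (cr d (s i)).
Proof.
move=> hd hi h0; have d4 : d < 4 by case: hd => ->.
have o4 : opp d < 4 by case: hd => ->.
have hj : 0 < pr d i <= l by rewrite h0 pr_range.
have [_ _ /(_ d d4 h0) lts] := hs hi.
have [hB1 hB2] := hB.
have := hB2 d i d4 hi; rewrite /fires 2!negb_or -ltnNge => /and3P [k1 _ _].
have := hB2 _ _ o4 hj; rewrite /fires 2!negb_or -ltnNge pr_opp // => /and3P [k2 _ _].
have [_ /(_ _ hi) ?] := hB1 _ o4; have [_ /(_ _ hj) ?] := hB1 _ o4.
have ej := cr_opp; have [pi _ ei hi'] := corner d4 hi; have [pj _ ej' hj'] := corner d4 hj.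
have := cr_opp d4 pi; have := cr_opp d4 pj; have := hi' _ o4; have := hj' _ o4.
by rewrite /clampv; lia.
Qed.

Lemma clamp_in_box : solution clamp /\ in_box B clamp.
Proof.
have lt02 d i : d = 0 \/ d = 2 -> 0 < i <= l -> 0 < pr d i ->
    cr d (clamp (pr d i)) < cr d (clamp i).
  move=> hd hi h0; have d4 : d < 4 by case: hd => ->.
  have hj : 0 < pr d i <= l by rewrite h0 pr_range.
  have [[_ _ a1 a2] [_ _ b1 b2]] := (clampP hi, clampP hj).
  by have := clampv_lt hd hi h0; case: hd b1 b2 => -> /=; rewrite ?a1 ?a2 => b1 b2; rewrite ?b1 ?b2.
split.
- move=> i hi; have [r c _ _] := clampP hi; split=> // d hd h0.
  have hj : 0 < pr d i <= l by rewrite h0 pr_range.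
  have [rj _ _ _] := clampP hj.
  (* Directions 1 and 3 are their opposites read from the predecessor. *)
  have [E|E] : (d = 0 \/ d = 2) \/ (opp d = 0 \/ opp d = 2).
    by case: d hd {h0 hj rj} => [|[|[|[|d]]]] //= _; auto.
    exact: lt02.
  have := lt02 _ _ E hj; rewrite pr_opp // => /(_ _) lt.
  have {}lt := lt (proj1 (andP hi)).
  by have := cr_opp hd r; have := cr_opp hd rj; lia.
- move=> d i hd hi; have [r c e0 e2] := clampP hi.
  have [u v] := (@cr_opp 0 _ isT r, @cr_opp 2 _ isT r).
  have [p0 _ q0 b0] := @corner 0 i isT hi; have w0 := @cr_opp 0 _ isT p0.
  have [p2 _ q2 b2] := @corner 2 i isT hi; have w2 := @cr_opp 2 _ isT p2.
  move: (b0 1 isT) (b2 3 isT) u v w0 w2 e0 e2 => /=; rewrite /clampv.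
  by case: d hd => [|[|[|[|d]]]] //= _; lia.
Qed.

End Clamp.

(** Opposite coordinates sum to [n.+1], so such a box contains no point but [q]. The inequality,
    unlike an equality, visibly survives further raising. *)
Definition pinned (B : nat -> nat -> nat) i :=
  exists2 q, 0 < q <= n & forall d, d < 4 -> cr d q <= B d i.

(** Every corner of a consistent box lies in the box, hence equals [q]. The sides are then the
    coordinates of [q], and the order tests that do not fire are the constraints of a solution. *)
Lemma pinned_solution B : consistent B -> (forall i, 0 < i <= l -> pinned B i) ->
  exists s, solution s.
Proof.
move=> hB hp; exists (fun i => point 0 (B 0 i)) => i hi.
have key j : 0 < j <= l -> forall d, d < 4 -> cr d (point 0 (B 0 j)) = B d j.
  move=> hj d hd; have [q hq hqB] := hp j hj.
  have [p0 c0 e0 h0] := @corner _ hB 0 j isT hj.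
  have <- : q = point 0 (B 0 j).
    rewrite -(@crK 0 q) //; congr point.
    have := h0 1 isT; have := hqB 0 isT; have := hqB 1 isT.
    by have := @cr_opp 0 _ isT hq; have := @cr_opp 0 _ isT p0 => /=; lia.
  have [pd cd ed hd'] := corner hB hd hj.
  have o4 : opp d < 4 by case: d hd {hd' cd ed pd} => [|[|[|[|]]]].
  have := hd' _ o4; have := hqB _ hd; have := hqB _ o4.
  by have := cr_opp hd hq; have := cr_opp hd pd; lia.
have [p0 c0 e0 h0] := @corner _ hB 0 i isT hi.
split=> // d hd hp0; rewrite !key //; last by rewrite hp0 pr_range.
by have [_ /(_ d i hd hi)] := hB; rewrite /fires 2!negb_or -ltnNge => /and3P [].
Qed.

End Search.

(** * Permutations as inputs of the propagation *)

(* The value is 0 outside of the image of [f]. *)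
Definition inv m (f : nat -> nat) v := nth 0 (iota 1 m) (index v (map f (iota 1 m))).

Section Inverse.
Variables (m : nat) (f : nat -> nat).
Hypothesis f_range : forall i, 0 < i <= m -> 0 < f i <= m.
Hypothesis f_inj : forall i j, 0 < i <= m -> 0 < j <= m -> f i = f j -> i = j.

Lemma inv_out v : ~~ (0 < v <= m) -> inv m f v = 0.
Proof.
move=> hv; rewrite /inv memNindex ?size_map ?nth_default //.
apply/mapP => -[i]; rewrite mem_iota => hi E; move/negP: hv; apply.
by rewrite E f_range //; lia.
Qed.

(** An injective map of a finite set into itself is onto, by counting. *)
Lemma inv_mem v : 0 < v <= m -> v \in map f (iota 1 m).
Proof.
have [] := @uniq_min_size _ (map f (iota 1 m)) (iota 1 m).
- rewrite map_inj_in_uniq ?iota_uniq // => i j; rewrite !mem_iota => hi hj.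
  by apply: f_inj; lia.
- move=> x /mapP [i]; rewrite !mem_iota => hi ->.
  by have := @f_range i; lia.
- by rewrite size_map !size_iota.
- by move=> _ E hv; rewrite E mem_iota; lia.
Qed.

Lemma inv_range v : 0 < v <= m -> 0 < inv m f v <= m.
Proof.
move=> /inv_mem; rewrite -index_mem size_map => h.
by have := mem_nth 0 h; rewrite mem_iota -/(inv m f v); lia.
Qed.

Lemma invK v : 0 < v <= m -> f (inv m f v) = v.
Proof.
move=> /inv_mem h; have := h; rewrite -index_mem size_map => h'.
by rewrite /inv -(nth_map 0 0) // nth_index.
Qed.

Lemma fK i : 0 < i <= m -> inv m f (f i) = i.
Proof.
by move=> hi; apply: f_inj => //; [apply/inv_range/f_range|apply/invK/f_range].
Qed.

End Inverse.

Definition crd (p : lpoints) d i :=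
  match d with
  | 0 => (pt p i).1
  | 1 => (len p).+1 - (pt p i).1
  | 2 => (pt p i).2
  | _ => (len p).+1 - (pt p i).2
  end.

Section Reduced.
Variable p : lpoints.
Hypothesis red : reduced p.

Lemma mem_supp i : (i \in supp p) = (0 < i <= len p).
Proof. by have [_ -> _] := red; rewrite inE /= mem_iota; lia. Qed.

Lemma crd_range d i : d < 4 -> 0 < i <= len p -> 0 < crd p d i <= len p.
Proof.
rewrite -mem_supp => hd hi; have [_ _ h] := red.
have := h i hi Axis1; have := h i hi Axis2.
by case: d hd => [|[|[|[|d]]]] //= _; lia.
Qed.

Lemma crd_opp d i : d < 4 -> 0 < i <= len p -> crd p (opp d) i + crd p d i = (len p).+1.
Proof.
move=> hd hi; have := crd_range (isT : 0 < 4) hi; have := crd_range (isT : 2 < 4) hi.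
by case: d hd => [|[|[|[|d]]]] //= _; lia.
Qed.

Lemma crd_inj d i j : d < 4 -> 0 < i <= len p -> 0 < j <= len p ->
  crd p d i = crd p d j -> i = j.
Proof.
move=> hd hi hj E; apply/eqP; apply: contraT => ne.
have [[_ _ gp] _ _] := red; rewrite -!mem_supp in hi hj.
have := gp Axis1 _ _ hi hj ne; have := gp Axis2 _ _ hi hj ne; move: E.
have := crd_opp (isT : 0 < 4) (etrans (esym (mem_supp i)) hi).
have := crd_opp (isT : 2 < 4) (etrans (esym (mem_supp i)) hi).
have := crd_opp (isT : 0 < 4) (etrans (esym (mem_supp j)) hj).
have := crd_opp (isT : 2 < 4) (etrans (esym (mem_supp j)) hj).
have := crd_range (isT : 0 < 4) (etrans (esym (mem_supp i)) hi).
have := crd_range (isT : 2 < 4) (etrans (esym (mem_supp i)) hi).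
have := crd_range (isT : 0 < 4) (etrans (esym (mem_supp j)) hj).
have := crd_range (isT : 2 < 4) (etrans (esym (mem_supp j)) hj).
by case: d hd => [|[|[|[|d]]]] //= _; lia.
Qed.

Definition crd_inv d v := inv (len p) (crd p d) v.

Lemma crd_invK d b : d < 4 -> 0 < b <= len p -> crd p d (crd_inv d b) = b.
Proof.
by move=> hd; apply: invK => *; [exact: crd_range|exact: (@crd_inj d)].
Qed.

Lemma crdK d i : d < 4 -> 0 < i <= len p -> crd_inv d (crd p d i) = i.
Proof.
by move=> hd; apply: fK => *; [exact: crd_range|exact: (@crd_inj d)].
Qed.

Lemma crd_inv_range d b : d < 4 -> 0 < b <= len p -> 0 < crd_inv d b <= len p.
Proof.
by move=> hd; apply: inv_range => *; [exact: crd_range|exact: (@crd_inj d)].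
Qed.

Lemma crd_inv_out d b : d < 4 -> ~~ (0 < b <= len p) -> crd_inv d b = 0.
Proof. by move=> hd; apply: inv_out => *; exact: crd_range. Qed.

(** At coordinate 1 the inverse is taken at 0, outside its range, and yields 0, the code of a
    missing predecessor. *)
Definition pred_in d i := crd_inv d (crd p d i).-1.

Lemma pred_in_range d i : d < 4 -> 0 < i <= len p -> pred_in d i <= len p.
Proof.
move=> hd hi; rewrite /pred_in; have [h|h] := boolP (0 < (crd p d i).-1 <= len p).
  by have := crd_inv_range hd h; lia.
by rewrite crd_inv_out.
Qed.

Lemma pred_in_gt0 d i : d < 4 -> 0 < i <= len p ->
  (0 < pred_in d i) = (1 < crd p d i).
Proof.
move=> hd hi; rewrite /pred_in; have := crd_range hd hi.
have [h|h] := boolP (0 < (crd p d i).-1 <= len p).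
  by have := crd_inv_range hd h; lia.
by rewrite crd_inv_out //; lia.
Qed.

Lemma crd_pred_in d i : d < 4 -> 0 < i <= len p -> 0 < pred_in d i ->
  crd p d i = (crd p d (pred_in d i)).+1.
Proof.
move=> hd hi; rewrite pred_in_gt0 // => h; have := crd_range hd hi => h'.
by rewrite crd_invK //; lia.
Qed.

Lemma pred_in_opp d i : d < 4 -> 0 < i <= len p -> 0 < pred_in d i ->
  pred_in (opp d) (pred_in d i) = i.
Proof.
move=> hd hi h; have hj : 0 < pred_in d i <= len p by rewrite h pred_in_range.
have E := crd_pred_in hd hi h; have o1 := crd_opp hd hi; have o2 := crd_opp hd hj.
have o4 : opp d < 4 by case: d hd {h hj E o1 o2} => [|[|[|[|]]]].
rewrite {1}/pred_in; suff -> : (crd p (opp d) (pred_in d i)).-1 = crd p (opp d) i.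
  by rewrite crdK.
by lia.
Qed.

End Reduced.

(** * Embeddings as solutions for some assignment of classes *)

Definition class_of (Pi : seq {fset nat}) q := find (fun A : {fset nat} => q \in A) Pi.

Section Instance.
Variables (t : nat) (sigma pi : lpoints) (Pi : t.-tuple {fset nat}).
Hypotheses (rs : reduced sigma) (rp : reduced pi) (mp : monotone_partition pi Pi).

Notation l := (len sigma).
Notation n := (len pi).

Lemma class_ofE (i : 'I_t) q : q \in tnth Pi i -> class_of Pi q = i.
Proof.
move=> hq; have [_ dis _] := mp.
have hh : has (fun A : {fset nat} => q \in A) Pi.
  by apply/hasP; exists (tnth Pi i) => //; apply: mem_tnth.
have hf : class_of Pi q < t by move: hh; rewrite has_find size_tuple.
have := nth_find fset0 hh; rewrite -/(class_of Pi q).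
rewrite -(tnth_nth fset0 Pi (Ordinal hf)) => h.
have [<- //|ne] := eqVneq (Ordinal hf) i.
by have /fdisjointP /(_ q h) := dis _ _ ne; rewrite hq.
Qed.

Lemma class_ofP q : 0 < q <= n -> exists i : 'I_t, class_of Pi q = i /\ q \in tnth Pi i.
Proof.
rewrite -(mem_supp rp) => hq; have [/(_ q) [/(_ hq) [i hi] _] _ _] := mp.
by exists i; rewrite (class_ofE hi).
Qed.

Lemma class_mem (i : 'I_t) q : q \in tnth Pi i -> 0 < q <= n.
Proof. by move=> h; rewrite -(mem_supp rp); have [hq _ _] := mp; apply/hq; exists i. Qed.

Lemma class_of_monotone : same_class_monotone n (crd pi) (class_of Pi).
Proof.
(* No point has a class number of [t] or more, so either alternative holds vacuously there. *)
move=> c; have [ct|ct] := ltnP c t; last first.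
  left=> q q' hq hq' E; have [i [E' _]] := class_ofP hq.
  by have := ltn_ord i; lia.
have hm q : 0 < q <= n -> class_of Pi q = c -> q \in tnth Pi (Ordinal ct).
  move=> hq E; have [i [E' h]] := class_ofP hq.
  by have -> : Ordinal ct = i by apply: val_inj; rewrite /= -E.
have [_ _ /(_ (Ordinal ct)) [m|m]] := mp; [left|right];
  move=> q q' hq hq' E E'; have := m _ _ (hm _ hq E) (hm _ hq' E');
  by rewrite /lt_on /= => -[a b]; apply/idP/idP.
Qed.

(** Constraints on consecutive elements propagate to all pairs by induction on the difference of
    coordinates in [sigma]; order is reflected because distinct elements have distinct
    coordinates. *)
Lemma solution_subpattern G s :
  solution l n (pred_in sigma) (crd pi) (class_of Pi) G s -> subpattern sigma pi.
Proof.
move=> hs.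
have lt d : d < 4 -> forall k p p', 0 < p <= l -> 0 < p' <= l ->
    crd sigma d p' = crd sigma d p + k.+1 -> crd pi d (s p) < crd pi d (s p').
  move=> hd; elim=> [|k IH] p p' hp hp' E.
    have h0 : 0 < pred_in sigma d p'.
      by rewrite pred_in_gt0 // E; have := crd_range rs hd hp; lia.
    have [_ _ /(_ d hd h0)] := hs p' hp'; suff -> : pred_in sigma d p' = p by [].
    by rewrite /pred_in E addn1 /= crdK.
  have h0 : 0 < pred_in sigma d p' by rewrite pred_in_gt0 // E; lia.
  have hj : 0 < pred_in sigma d p' <= l by rewrite h0 pred_in_range.
  have [_ _ /(_ d hd h0)] := hs p' hp'; apply: ltn_trans; apply: IH => //.
  by have := crd_pred_in rs hd hp' h0; lia.
exists s; split=> [p|a p p'].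
  by rewrite !mem_supp // => /hs [].
rewrite !mem_supp // => hp hp'; set d := if a is Axis1 then 0 else 2.
have hd : d < 4 by rewrite /d; case: (a).
have -> : lt_on sigma a p p' = (crd sigma d p < crd sigma d p') by rewrite /d; case: (a).
have -> : lt_on pi a (s p) (s p') = (crd pi d (s p) < crd pi d (s p')) by rewrite /d; case: (a).
split=> [h|h].
  by apply: (lt _ hd (crd sigma d p' - (crd sigma d p).+1)) => //; lia.
have [//|h'] := ltnP (crd sigma d p) (crd sigma d p').
move: h'; rewrite leq_eqVlt => /orP [/eqP E|h'].
  by move: h; rewrite (crd_inj rs hd hp' hp E) ltnn.
have := lt _ hd (crd sigma d p - (crd sigma d p').+1) _ _ hp' hp.
by move=> /(_ _); lia.
Qed.

Lemma subpattern_solution : subpattern sigma pi ->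
  exists G, (forall i, 0 < i <= l -> G i < t) /\
    exists s, solution l n (pred_in sigma) (crd pi) (class_of Pi) G s.
Proof.
move=> [s [h1 h2]]; exists (fun i => class_of Pi (s i)).
have sr i : 0 < i <= l -> 0 < s i <= n by rewrite -!mem_supp //; apply: h1.
split=> [i /sr /class_ofP [j [-> _]] //|].
exists s => i hi; split=> // [|d hd h0]; first exact: sr.
have hj : 0 < pred_in sigma d i <= l by rewrite h0 pred_in_range.
have E := crd_pred_in rs hd hi h0.
have [hi' hj'] : i \in supp sigma /\ pred_in sigma d i \in supp sigma.
  by rewrite !mem_supp.
move: (crd_opp rp hd (sr _ hi)) (crd_opp rp hd (sr _ hj)) E.
move: (crd_opp rs hd hi) (crd_opp rs hd hj).
move: (h2 Axis1 _ _ hi' hj') (h2 Axis2 _ _ hi' hj') (h2 Axis1 _ _ hj' hi') (h2 Axis2 _ _ hj' hi').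
rewrite /lt_on; case: d hd {h0 hj hj'} => [|[|[|[|d]]]] //= _; lia.
Qed.

End Instance.

(** * Assignments of classes as numbers in base [t] *)

(* Digits are numbered from 1, the least significant first. *)
Fixpoint odo_val t (G : nat -> nat) k :=
  if k is k'.+1 then odo_val t G k' + G k * t ^ k' else 0.

Lemma odo_val_ext t G G' k : (forall i, 0 < i <= k -> G i = G' i) ->
  odo_val t G k = odo_val t G' k.
Proof.
elim: k => //= k IH h; rewrite IH ?h ?ltnS ?leqnn // => i hi; apply: h; lia.
Qed.

Lemma odo_val_lt t G k : (forall i, 0 < i <= k -> G i < t) -> odo_val t G k < t ^ k.
Proof.
elim: k => //= k IH h; have {}IH : odo_val t G k < t ^ k by apply: IH => i hi; apply: h; lia.
have : (G k.+1).+1 * t ^ k <= t * t ^ k by rewrite leq_mul2r h ?orbT //; lia.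
by rewrite expnS mulSn; lia.
Qed.

(** Division by [t ^ k] isolates the leading digit. Uniqueness lets a count up to [t ^ l] stand for
    all assignments. *)
Lemma odo_val_inj t G G' k : (forall i, 0 < i <= k -> G i < t) ->
  (forall i, 0 < i <= k -> G' i < t) -> odo_val t G k = odo_val t G' k ->
  forall i, 0 < i <= k -> G i = G' i.
Proof.
elim: k => [|k IH] h h' /= E i hi; first by lia.
have l1 : odo_val t G k < t ^ k by apply: odo_val_lt => j hj; apply: h; lia.
have l2 : odo_val t G' k < t ^ k by apply: odo_val_lt => j hj; apply: h'; lia.
have t0 : 0 < t ^ k by lia.
have Eq : G k.+1 = G' k.+1.
  by have := congr1 (fun x => x %/ t ^ k) E; rewrite /= !divnDMl // !divn_small.
have [->//|ne] := eqVneq i k.+1.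
by apply: IH; [move=> j hj; apply: h; lia|move=> j hj; apply: h'; lia|move: E; rewrite Eq; lia|lia].
Qed.

(** * The input word *)

Lemma size_encode_points p : size (encode_points p) = 2 * len p.
Proof.
rewrite /encode_points -[in RHS](size_iota 1 (len p)).
by elim: (iota _ _) => //= i s ->; rewrite mulnS.
Qed.

Lemma nth_encode_points p i : 0 < i <= len p ->
  nth 0 (encode_points p) (2 * i.-1) = (pt p i).1 /\
  nth 0 (encode_points p) (2 * i.-1).+1 = (pt p i).2.
Proof.
case: i => // i /= hi; rewrite /encode_points.
suff H m a j : j < m ->
    nth 0 (flatten [seq [:: (pt p q).1; (pt p q).2] | q <- iota a m]) (2 * j) =
      (pt p (a + j)).1 /\
    nth 0 (flatten [seq [:: (pt p q).1; (pt p q).2] | q <- iota a m]) (2 * j).+1 =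
      (pt p (a + j)).2 by exact: H.
elim: m a j => // m IH a [|j] hj; first by rewrite addn0 muln0.
by rewrite mulnS addnS -addSn; exact: IH.
Qed.

Section Encoding.
Variables (t : nat) (sigma pi : lpoints) (Pi : t.-tuple {fset nat}).
Hypotheses (rs : reduced sigma) (rp : reduced pi) (mp : monotone_partition pi Pi).

Notation l := (len sigma).
Notation n := (len pi).
Notation inp := (encode sigma pi Pi).

Definition class_pos k := size (flatten (map encode_class (take k Pi))).
Notation class_at k := (nth fset0 (tval Pi) k).

Lemma size_encode_class (B : {fset nat}) : size (encode_class B) = #|` B|.+1.
Proof. by rewrite /= size_sort. Qed.

Lemma class_posS k : k < t -> class_pos k.+1 = class_pos k + #|` class_at k|.+1.
Proof.
move=> hk; rewrite /class_pos (take_nth fset0) ?size_tuple //.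
by rewrite map_rcons flatten_rcons size_cat size_encode_class.
Qed.

Lemma size_encode : size inp = 3 + 2 * l + 2 * n + class_pos t.
Proof.
rewrite /encode !size_cat /= !size_encode_points /class_pos take_oversize ?size_tuple //.
by lia.
Qed.

Lemma class_at_mem k q : k < t -> q \in class_at k -> 0 < q <= n.
Proof.
by move=> hk; rewrite -(tnth_nth fset0 Pi (Ordinal hk)); apply: class_mem mp _ _.
Qed.

Lemma class_at_of k q : k < t -> q \in class_at k -> class_of Pi q = k.
Proof.
by move=> hk; rewrite -(tnth_nth fset0 Pi (Ordinal hk)) => /(class_ofE mp).
Qed.

Lemma card_class_at k : k < t -> #|` class_at k| <= n.
Proof.
move=> hk; rewrite /len; apply: fsubset_leq_card; apply/fsubsetP => q hq.
by rewrite mem_supp //; apply: class_at_mem hq.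
Qed.

(** This bound depends on [t] and [n] only, so the program can place its arrays after the input
    before reading the classes. *)
Lemma class_pos_le : class_pos t <= t * n.+1.
Proof.
suff h k : k <= t -> class_pos k <= k * n.+1 by apply: h.
elim: k => [|k IH] hk; first by rewrite /class_pos take0.
by rewrite class_posS // mulSn; have := card_class_at hk; have := IH (ltnW hk); lia.
Qed.

(** Even an empty class occupies the word for its length, so [t] is at most the size of the
    input. *)
Lemma class_pos_ge : t <= class_pos t.
Proof.
suff h k : k <= t -> k <= class_pos k by apply: h.
elim: k => [|k IH] hk //; rewrite class_posS //.
by have := IH (ltnW hk); lia.
Qed.

Lemma nth_encode_head : [/\ nth 0 inp 0 = l, nth 0 inp 1 = n & nth 0 inp 2 = t].
Proof. by split=> //=; rewrite size_tuple. Qed.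

(** Three header words and numbering from 1 give the address [3 + 2 * (i - 1)]. *)
Lemma nth_encode_sigma i : 0 < i <= l ->
  nth 0 inp (1 + 2 * i) = crd sigma 0 i /\ nth 0 inp (1 + (2 * i).+1) = crd sigma 2 i.
Proof.
move=> hi; have [h1 h2] := nth_encode_points hi.
have -> : 1 + 2 * i = 3 + 2 * i.-1 by lia.
have -> : 1 + (2 * i).+1 = 3 + (2 * i.-1).+1 by lia.
by rewrite /encode /= !nth_cat !size_encode_points !ifT ?h1 ?h2 //; lia.
Qed.

Lemma nth_encode_pi i : 0 < i <= n ->
  nth 0 inp (1 + 2 * l + 2 * i) = crd pi 0 i /\
  nth 0 inp (1 + 2 * l + (2 * i).+1) = crd pi 2 i.
Proof.
move=> hi; have [h1 h2] := nth_encode_points hi.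
have -> : 1 + 2 * l + 2 * i = 3 + (2 * l + 2 * i.-1) by lia.
have -> : 1 + 2 * l + (2 * i).+1 = 3 + (2 * l + (2 * i.-1).+1) by lia.
rewrite /encode /= !nth_cat !size_encode_points.
rewrite ifF; last by lia.
rewrite ifT; last by lia.
rewrite ifF; last by lia.
rewrite ifT; last by lia.
by rewrite !add0n !addKn.
Qed.

Lemma nth_encode_class k j : k < t -> j <= #|` class_at k| ->
  nth 0 inp (3 + 2 * l + 2 * n + class_pos k + j) = nth 0 (encode_class (class_at k)) j.
Proof.
move=> hk hj.
have -> : 3 + 2 * l + 2 * n + class_pos k + j = 3 + (2 * l + (2 * n + (class_pos k + j))).
  by lia.
have := size_encode_class (class_at k); set Y := encode_class (class_at k) => hY.
have -> : inp = [:: l; n; size Pi] ++ encode_points sigma ++ encode_points pi ++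
    flatten (map encode_class (take k Pi)) ++ Y ++
    flatten (map encode_class (drop k.+1 Pi)).
  by rewrite /Y /encode -[in X in flatten X](cat_take_drop k Pi) map_cat flatten_cat
    (drop_nth fset0) ?size_tuple.
clearbody Y; rewrite /= add0n nth_cat size_encode_points ifF; last by lia.
rewrite addKn nth_cat size_encode_points ifF; last by lia.
rewrite addKn nth_cat -/(class_pos k) ifF; last by lia.
by rewrite addKn nth_cat hY ltnS hj.
Qed.

Lemma nth_class_mem (B : {fset nat}) j : j < #|` B| -> nth 0 (encode_class B) j.+1 \in B.
Proof. by move=> hj; rewrite /= -(mem_sort leq) mem_nth // size_sort. Qed.

Lemma class_mem_nth (B : {fset nat}) q : q \in B ->
  exists2 j, j < #|` B| & nth 0 (encode_class B) j.+1 = q.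
Proof.
move=> hq; exists (index q (sort leq (enum_fset B))).
  by rewrite -(size_sort leq) index_mem mem_sort.
by rewrite /= nth_index ?mem_sort.
Qed.

(** Needed for the initial state to be bounded: no input word exceeds the length of the input. *)
Lemma nth_encode_le a : nth 0 inp a <= size inp.
Proof.
have [h|h] := ltnP a (size inp); last by rewrite nth_default.
have hs := size_encode; have ht := class_pos_ge.
have hpts p : reduced p -> all (fun x => x <= len p) (encode_points p).
  move=> r; apply/allP => x /flattenP [s /mapP [i]]; rewrite mem_iota => hi ->.
  have hi' : 0 < i <= len p by lia.
  have := crd_range r (isT : 0 < 4) hi'; have := crd_range r (isT : 2 < 4) hi'.
  by rewrite /= !inE => ? ? /orP [] /eqP ->; lia.
suff : all (fun x => x <= size inp) inp by move=> /allP; apply; apply: mem_nth.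
rewrite hs /encode !all_cat; apply/and4P; split.
- by rewrite /= size_tuple andbT; lia.
- by apply: sub_all (hpts _ rs) => x /=; lia.
- by apply: sub_all (hpts _ rp) => x /=; lia.
- apply/allP => x /flattenP [s /mapP [B /(nthP fset0) [k]]]; rewrite size_tuple => hk <- ->.
  rewrite /encode_class inE => /orP [/eqP ->|].
  by apply: leq_trans (card_class_at hk) _; lia.
by rewrite mem_sort => /(class_at_mem hk); lia.
Qed.

End Encoding.

(** * Reasoning about timed executions *)

Local Notation cell := Defs.mem.

(** Evaluation without guards; [eval_den] shows that it agrees with [eval] on light expressions in
    bounded states. *)
Fixpoint den (s : state) (e : expr) : nat :=
  match e with
  | Const v => v
  | Reg r => reg s r
  | Fetch e1 => cell s (den s e1)
  | Op o e1 e2 => binop_fun o (den s e1) (den s e2)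
  end.

(* If no register or cell exceeds [M], then an expression has value at most
   [weight e * M].  Light expressions thus never overflow as soon as
   [200 * M < word]; products other than by a constant are never light. *)
Fixpoint weight (e : expr) : nat :=
  match e with
  | Const v => v
  | Reg _ | Fetch _ => 1
  | Op Add e1 e2 => weight e1 + weight e2
  | Op Defs.Sub e1 _ => weight e1
  | Op Mul (Const v) e2 => v * weight e2
  | Op Mul _ _ => 201
  | Op _ _ _ => 1
  end.

Fixpoint light (e : expr) : bool :=
  (weight e <= 200) &&
  match e with
  | Const _ | Reg _ => true
  | Fetch e1 => light e1
  | Op _ e1 e2 => light e1 && light e2
  end.

Definition bounded (M : nat) (s : state) : Prop :=
  (forall r, reg s r <= M) /\ (forall a, cell s a <= M).

(* The memory above the input, which starts at the address held in register 1,
   is shared by 32 interleaved unbounded arrays; [elt s j i] is cell [i] of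
   array [j]. *)
Definition arr j e := Op Add (Op Add (Reg 1) (Op Mul (Const 32) e)) (Const j).
Definition ld j e := Fetch (arr j e).
Definition elt (s : state) (j i : nat) : nat := cell s (reg s 1 + 32 * i + j).

(** The array addressed by an expression, recognized by its syntax. The value 32 marks any other
    address and is rejected by [framed]. *)
Definition arr_of (e : expr) : nat :=
  match e with
  | Op Add (Op Add (Reg r) (Op Mul (Const k) _)) (Const j) =>
      if (r == 1) && (k == 32) then j else 32
  | _ => 32
  end.

Fixpoint wregs c : seq nat :=
  match c with
  | Assign r _ => [:: r]
  | Seq c1 c2 | If _ c1 c2 => wregs c1 ++ wregs c2
  | While _ c1 => wregs c1
  | _ => [::]
  end.

Fixpoint warrs c : seq nat :=
  match c with
  | Store e _ => [:: arr_of e]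
  | Seq c1 c2 | If _ c1 c2 => warrs c1 ++ warrs c2
  | While _ c1 => warrs c1
  | _ => [::]
  end.

Definition frame (rs js : seq nat) (s s' : state) : Prop :=
  [/\ forall r, r \notin rs -> reg s' r = reg s r,
      forall a, a < reg s 1 -> cell s' a = cell s a &
      forall j i, j < 32 -> j \notin js -> elt s' j i = elt s j i].

(** Register 1 must not change, since both the protected input area and [elt] are relative to it. *)
Definition framed c := (1 \notin wregs c) && all (fun j => j < 32) (warrs c).

Lemma frame_trans rs js s1 s2 s3 :
  1 \notin rs -> frame rs js s1 s2 -> frame rs js s2 s3 -> frame rs js s1 s3.
Proof.
move=> r1 [a1 b1 c1] [a2 b2 c2]; split.
- by move=> r hr; rewrite a2 // a1.
- by move=> a ha; rewrite b2 ?b1 // a1.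
- by move=> j i hj hi; rewrite c2 ?c1.
Qed.

Lemma frame_sub rs js rs' js' s s' :
  {subset rs <= rs'} -> {subset js <= js'} -> frame rs js s s' -> frame rs' js' s s'.
Proof.
move=> sr sj [a b c]; split=> //.
- by move=> r hr; apply: a; apply: contra hr; apply: sr.
- by move=> j i hj hn; apply: c => //; apply: contra hn; apply: sj.
Qed.

Lemma arr_ofP s e : arr_of e < 32 ->
  exists i, den s e = reg s 1 + 32 * i + arr_of e.
Proof.
case: e => // -[] // [] // [] // [] // r [] // [] // [] // k e2 [] // j /=.
by case: ifP => // /andP [/eqP -> /eqP ->] _; exists (den s e2).
Qed.

Definition set_elt s j i v := set_mem s (reg s 1 + 32 * i + j) v.

(** The array number is the residue modulo 32 of the offset from register 1, so distinct arrays
    never overlap. *)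
Lemma elt_set_elt s j i v j' i' : j < 32 -> j' < 32 ->
  elt (set_elt s j i v) j' i' = if (j' == j) && (i' == i) then v else elt s j' i'.
Proof.
move=> hj hj'; rewrite /elt /set_elt /= /upd.
have -> : (reg s 1 + 32 * i' + j' == reg s 1 + 32 * i + j) = (j' == j) && (i' == i).
  by apply/eqP/andP => [h|[/eqP -> /eqP ->] //]; split; apply/eqP; lia.
by [].
Qed.

Lemma frame_set_elt s j i v : j < 32 -> frame [::] [:: j] s (set_elt s j i v).
Proof.
move=> hj; split=> // [a ha|j' i' hj'].
  by rewrite /= /upd; case: eqP => // ?; lia.
by rewrite inE elt_set_elt // => /negPf ->.
Qed.

Lemma frame_set_reg s r v : r != 1 -> frame [:: r] [::] s (set_reg s r v).
Proof.
move=> hr; split=> // [r'|j i _ _]; first by rewrite inE /= /upd => /negPf ->.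
by rewrite /elt /= /upd eq_sym (negPf hr).
Qed.

Lemma frame_elt rs js s s1 j i v : (1 \notin rs) && (j < 32) && (j \in js) ->
  frame rs js s s1 -> frame rs js s (set_elt s1 j i v).
Proof.
move=> /andP [/andP [h1 hj] hm] h; apply: (frame_trans h1 h).
by apply: frame_sub (frame_set_elt _ _ _ hj) => // x; rewrite inE => /eqP ->.
Qed.

Lemma frame_reg rs js s s1 r v : (1 \notin rs) && (r \in rs) ->
  frame rs js s s1 -> frame rs js s (set_reg s1 r v).
Proof.
move=> /andP [h1 hm] h; apply: (frame_trans h1 h).
have hr : r != 1 by apply: contraNneq h1 => <-.
by apply: frame_sub (frame_set_reg _ _ hr) => // x; rewrite inE => /eqP ->.
Qed.

(** Worst-case time of loop-free code; 0 is a placeholder for loops. *)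
Fixpoint tcost c : nat :=
  match c with
  | Skip => 1
  | Assign _ e => (cost e).+1
  | Store e1 e2 => (cost e1 + cost e2).+1
  | Seq c1 c2 => tcost c1 + tcost c2
  | If e c1 c2 => (cost e + maxn (tcost c1) (tcost c2)).+1
  | While _ _ => 0
  end.

Section Run.
Variables (W M : nat).
Hypotheses (M_gt0 : 0 < M) (MW : 200 * M < W).

Lemma den_le s e : bounded M s -> light e -> den s e <= weight e * M.
Proof.
move=> [hr hm].
elim: e => [v|r|e IH|o e1 IH1 e2 IH2].
- by move=> _ /=; rewrite leq_pmulr.
- by move=> _ /=; rewrite mul1n.
- by move=> _ /=; rewrite mul1n.
- move=> h; have [h1 h2] : light e1 /\ light e2 by move: h => /= /and3P [].
  have h0 : weight (Op o e1 e2) <= 200 by move: h => /= /and3P [].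
  move: (IH1 h1) (IH2 h2) => k1 k2; case: o h h0 => /= _ h0.
  + nia.
  + nia.
  + by case: e1 h0 k1 {IH1 h1} => //= v h0 _; nia.
  + nia.
  + nia.
Qed.

Lemma den_lt s e : bounded M s -> light e -> den s e < W.
Proof.
move=> hb he; have := den_le hb he.
have : weight e <= 200 by case: e he => //= [?|? ? ?] /andP [].
nia.
Qed.

Lemma eval_den s e : bounded M s -> light e -> eval W W s e = Some (den s e).
Proof.
move=> hb; elim: e => [v|r|e IH|o e1 IH1 e2 IH2] he.
- by rewrite /= /guard_lt (den_lt hb he).
- by rewrite /= /guard_lt (den_lt hb he).
- have he1 : light e by [].
  by rewrite /= IH //= /guard_lt (den_lt hb he1) /= (den_lt hb he).
- have [h1 h2] : light e1 /\ light e2 by move: he => /= /and3P [].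
  by rewrite /= IH1 //= IH2 //= /guard_lt (den_lt hb he).
Qed.

(** A total-correctness triple at one initial state, with a time bound. Boundedness is assumed and
    restored inside, so it passes silently through compositions. *)
Definition run c s T (Q : state -> Prop) : Prop :=
  bounded M s -> exists T' s',
    [/\ exec W W c s T' s', T' <= T, bounded M s' & Q s'].

Lemma run_le c s T T' (Q Q' : state -> Prop) :
  run c s T Q -> T <= T' -> (forall s', Q s' -> Q' s') -> run c s T' Q'.
Proof.
move=> h hT hQ hb; have [T1 [s1 [h1 h2 h3 h4]]] := h hb.
by exists T1, s1; split=> //; [apply: leq_trans hT | apply: hQ].
Qed.

Lemma run_leT c s T T' (Q : state -> Prop) : run c s T Q -> T <= T' -> run c s T' Q.
Proof. by move=> h hT; apply: run_le h hT _. Qed.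

Lemma run_bounded c s T Q :
  (bounded M s -> run c s T Q) -> run c s T Q.
Proof. by move=> h hb; apply: h. Qed.

Lemma run_skip s (Q : state -> Prop) : Q s -> run Skip s 1 Q.
Proof. by move=> h hb; exists 1, s; split=> //; constructor. Qed.

Lemma bounded_reg s r v : bounded M s -> v <= M -> bounded M (set_reg s r v).
Proof. by move=> [h1 h2] hv; split=> //= r'; rewrite /upd; case: ifP. Qed.

Lemma bounded_mem s a v : bounded M s -> v <= M -> bounded M (set_mem s a v).
Proof. by move=> [h1 h2] hv; split=> //= r'; rewrite /upd; case: ifP. Qed.

Lemma run_assign s r e (Q : state -> Prop) :
  light e -> (bounded M s -> den s e <= M) -> Q (set_reg s r (den s e)) ->
  run (Assign r e) s (cost e).+1 Q.
Proof.
move=> he hv hQ hb; exists (cost e).+1, (set_reg s r (den s e)).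
split=> //; last by apply: bounded_reg; auto.
by constructor; apply: eval_den.
Qed.

Lemma run_store s e1 e2 (Q : state -> Prop) :
  light e1 -> light e2 -> (bounded M s -> den s e2 <= M) ->
  Q (set_mem s (den s e1) (den s e2)) ->
  run (Store e1 e2) s (cost e1 + cost e2).+1 Q.
Proof.
move=> he1 he2 hv hQ hb.
exists (cost e1 + cost e2).+1, (set_mem s (den s e1) (den s e2)).
split=> //; last by apply: bounded_mem; auto.
by apply: ExecStore; [apply: eval_den | apply: den_lt | apply: eval_den].
Qed.

Lemma run_store_arr s j e1 e2 (Q : state -> Prop) :
  light (arr j e1) -> light e2 -> (bounded M s -> den s e2 <= M) ->
  Q (set_elt s j (den s e1) (den s e2)) ->
  run (Store (arr j e1) e2) s (cost (arr j e1) + cost e2).+1 Q.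
Proof. by move=> h1 h2 h3 h4; apply: run_store. Qed.

Lemma run_seq c1 c2 s T1 T2 Q :
  run c1 s T1 (fun s1 => run c2 s1 T2 Q) -> run (Seq c1 c2) s (T1 + T2) Q.
Proof.
move=> h1 hb; have [U1 [s1 [e1 le1 b1 /(_ b1) [U2 [s2 [e2 le2 b2 hQ]]]]]] := h1 hb.
exists (U1 + U2), s2; split=> //; last exact: leq_add.
exact: ExecSeq e1 e2.
Qed.

Lemma run_if e c1 c2 s T1 T2 Q : light e ->
  (den s e <> 0 -> run c1 s T1 Q) -> (den s e = 0 -> run c2 s T2 Q) ->
  run (If e c1 c2) s (cost e + maxn T1 T2).+1 Q.
Proof.
move=> he h1 h2 hb.
have [d0|d0] := eqVneq (den s e) 0.
  have [T [s' [ex le b hQ]]] := h2 d0 hb.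
  exists (cost e + T).+1, s'; split=> //; last by lia.
  apply: ExecIf; first exact: eval_den.
  by rewrite d0.
have [T [s' [ex le b hQ]]] := h1 (elimN eqP d0) hb.
exists (cost e + T).+1, s'; split=> //; last by lia.
apply: ExecIf; first exact: eval_den.
by rewrite d0.
Qed.

(** The index [m] of the invariant is both variant and budget: its strict decrease pays for one
    iteration. *)
Lemma run_while e c (I : nat -> state -> Prop) Tc m s (Q : state -> Prop) :
  light e -> I m s ->
  (forall m s, I m s -> den s e <> 0 ->
     run c s Tc (fun s' => exists2 m', m' < m & I m' s')) ->
  (forall m s, I m s -> den s e = 0 -> Q s) ->
  run (While e c) s ((cost e).+1 + m * (cost e + Tc).+1) Q.
Proof.
move=> he hI hc hQ; elim/ltn_ind: m s hI => m IH s hI hb.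
have [d0|d0] := eqVneq (den s e) 0.
  exists (cost e).+1, s; split=> //; [|by lia|exact: hQ hI d0].
  by constructor; rewrite eval_den ?d0.
have [T1 [s1 [e1 le1 b1 [m' hm hI']]]] := hc _ _ hI (elimN eqP d0) hb.
have [T2 [s2 [e2 le2 b2 hQ2]]] := IH _ hm _ hI' b1.
exists (cost e + T1 + T2).+1, s2; split=> //; last first.
  have : m'.+1 * (cost e + Tc).+1 <= m * (cost e + Tc).+1 by rewrite leq_mul2r hm orbT.
  by rewrite mulSn; lia.
by apply: ExecWhileStep e1 e2; first exact: eval_den.
Qed.

(** What a command preserves is read off its syntax, which spares the loop invariants from listing
    it. *)
Lemma exec_frame c s T s' : bounded M s ->
  exec W W c s T s' -> framed c -> frame (wregs c) (warrs c) s s'.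
Proof.
move=> _ H; elim: H => {c s T s'} //=.
- move=> s r e v _ /andP [] /=; rewrite inE => hr _; split=> //=.
    by move=> r'; rewrite inE /upd => /negPf ->.
  by move=> j i hj _; rewrite /elt /= /upd (negPf hr).
- move=> s e1 e2 i v ev _ _ /andP [] /= _; rewrite andbT => h.
  (* A successful guarded evaluation always yields the denotation, with no bound on the state. *)
  have -> : i = den s e1.
    elim: e1 i ev {h} => [w|w|e IH|o e IHe e' IHe'] i //=; rewrite /guard_lt.
    + by case: ifP => // _ [].
    + by case: ifP => // _ [].
    + case E: (eval W W s e) => [x|] //=; case: ifP => //= _; case: ifP => // _ [<-].
      by rewrite (IH _ E).
    + case E: (eval W W s e) => [x|] //=; case E': (eval W W s e') => [y|] //=.
      by case: ifP => // _ [<-]; rewrite (IHe _ E) (IHe' _ E').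
  by have [k ->] := arr_ofP s h; exact: frame_set_elt.
- move=> c1 c2 s T1 s1 T2 s2 _ IH1 _ IH2; rewrite /framed /= mem_cat all_cat negb_or.
  move=> /andP [/andP [n1 n2] /andP [a1 a2]].
  have f1 : framed c1 by rewrite /framed n1.
  have f2 : framed c2 by rewrite /framed n2.
  apply: (@frame_trans _ _ s s1 s2); first by rewrite mem_cat negb_or n1.
    by apply: frame_sub (IH1 f1) => x hx; rewrite mem_cat hx.
  by apply: frame_sub (IH2 f2) => x hx; rewrite mem_cat hx orbT.
- move=> e c1 c2 s v T s' _ _ IH; rewrite /framed /= mem_cat all_cat negb_or.
  move=> /andP [/andP [n1 n2] /andP [a1 a2]].
  case: ifP IH => _ IH.
    have f1 : framed c1 by rewrite /framed n1.
    by apply: frame_sub (IH f1) => x hx; rewrite mem_cat hx.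
  have f2 : framed c2 by rewrite /framed n2.
  by apply: frame_sub (IH f2) => x hx; rewrite mem_cat hx orbT.
- move=> e c s v T1 s1 T2 s2 _ _ _ IH1 _ IH2 hf.
  apply: (@frame_trans _ _ s s1 s2); first by case/andP: hf.
    exact: IH1.
  exact: IH2.
Qed.

Lemma run_frame c s T Q : framed c -> run c s T Q ->
  run c s T (fun s' => frame (wregs c) (warrs c) s s' /\ Q s').
Proof.
move=> hf h hb; have [T' [s' [h1 h2 h3 h4]]] := h hb.
by exists T', s'; split=> //; split=> //; apply: exec_frame h1 hf.
Qed.

(** The counter is incremented before the body, which thus sees the values from 1 on, as points are
    numbered. *)
Definition For r rb body :=
  Seq (Assign r (Const 0))
      (While (Op Lt (Reg r) (Reg rb))
         (Seq (Assign r (Op Add (Reg r) (Const 1))) body)).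

Lemma run_for r rb body (I : nat -> state -> Prop) m Tc s :
  r != rb -> r != 1 -> framed body -> r \notin wregs body -> rb \notin wregs body ->
  reg s rb = m -> I 0 (set_reg s r 0) ->
  (forall k s, k < m -> I k s -> reg s r = k -> reg s rb = m ->
     run body (set_reg s r k.+1) Tc (I k.+1)) ->
  run (For r rb body) s (m * (Tc + 8) + 6) (fun s' => reg s' r = m /\ I m s').
Proof.
move=> rrb r1 fb rn rbn hm hI hbody.
apply: (@run_le _ _ (2 + (4 + m * (3 + (4 + Tc)).+1)) _
         (fun s' => reg s' r = m /\ I m s')) => //; last by nia.
apply: run_seq; apply: (@run_assign _ _ (Const 0)) => //.
set s0 := set_reg _ _ _.
pose J k s := exists x, [/\ x + k = m, reg s r = x, reg s rb = m & I x s].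
apply: (@run_while _ _ J) => //.
- exists 0; split=> //=; first by rewrite /upd eqxx.
  by rewrite /upd eq_sym (negPf rrb).
- move=> k s1 [x [hx hr hrb hIx]] /=; rewrite hr hrb => hlt.
  have {}hlt : x < m by case: ltnP hlt.
  apply: run_seq; apply: run_bounded => hb; apply: run_assign => //=.
    by move=> [/(_ rb)]; rewrite hr hrb; lia.
  apply: (@run_le _ _ Tc _ _ _ (run_frame fb _)) => //=.
    by rewrite hr addn1; apply: hbody.
  move=> s2 [[f1 f2 f3] hI2]; exists (m - x.+1); first by lia.
  exists x.+1; split=> //; first by lia.
    by rewrite f1 //= /upd eqxx hr addn1.
  by rewrite f1 //= /upd eq_sym (negPf rrb).
- move=> k s1 [x [hx hr hrb hIx]] /=; rewrite hr hrb => hlt.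
  by have -> : m = x by case: ltnP hlt => // ? _; lia.
Qed.

(* One copy per direction. *)
Definition each f := Seq (f 0) (Seq (f 1) (Seq (f 2) (f 3))).

Definition set4 s j (idx v : nat -> nat) : state :=
  let st s d := set_elt s (j + d) (idx d) (v d) in
  st (st (st (st s 0) 1) 2) 3.

Lemma elt_set4 s j idx v j' i' : j + 3 < 32 -> j' < 32 ->
  elt (set4 s j idx v) j' i' =
  if (j <= j' < j + 4) && (i' == idx (j' - j)) then v (j' - j) else elt s j' i'.
Proof.
move=> hj hj'; rewrite /set4.
do 4 (rewrite elt_set_elt; [|lia|lia]).
case h: (j <= j' < j + 4) => /=; last first.
  by do 4 (case: ifP => [/andP [/eqP] ?|_]; first by lia).
have [d d4 ->] : exists2 d, d < 4 & j' = j + d by exists (j' - j); lia.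
rewrite addKn !eqn_add2l.
by case: d d4 => [|[|[|[|d]]]] //= _; case: ifP.
Qed.

Lemma frame_set4 s j idx v : j + 3 < 32 -> frame [::] (iota j 4) s (set4 s j idx v).
Proof.
move=> hj; split=> // [a ha|j' i' hj'].
  by rewrite /set4 /= /upd; do 4 (case: eqP => [?|_]; first by lia).
by rewrite mem_iota elt_set4 // => /negPf ->.
Qed.

(** Indices and values are computed in states that may differ from [s] in the four target arrays;
    the penultimate hypothesis says that this does not affect them. *)
Lemma run_each s j (e f : nat -> expr) (idx v : nat -> nat) (Q : state -> Prop) :
  j + 3 < 32 ->
  (forall d, d < 4 -> light (arr (j + d) (e d)) && light (f d)) ->
  (bounded M s -> forall d, d < 4 -> v d <= M) ->
  (forall d s', d < 4 -> frame [::] (iota j 4) s s' ->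
     den s' (e d) = idx d /\ den s' (f d) = v d) ->
  Q (set4 s j idx v) ->
  let c := each (fun d => Store (arr (j + d) (e d)) (f d)) in
  run c s (tcost c) Q.
Proof.
move=> hj hn hv hd hQ c; apply: run_bounded => hb.
have step s1 d Q' : d < 4 -> frame [::] (iota j 4) s s1 ->
   (frame [::] (iota j 4) s (set_elt s1 (j + d) (idx d) (v d)) ->
      Q' (set_elt s1 (j + d) (idx d) (v d))) ->
   run (Store (arr (j + d) (e d)) (f d)) s1 (cost (arr (j + d) (e d)) + cost (f d)).+1 Q'.
  move=> d4 f1 hQ'; have [h1 h2] := hd d s1 d4 f1; have /andP [n1 n2] := hn d d4.
  apply: run_store_arr => //; first by rewrite h2; auto.
  rewrite h1 h2; apply: hQ'; apply: (frame_trans _ f1) => //.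
  apply: (@frame_sub [::] [:: j + d]) => [//|x|]; last by apply: frame_set_elt; lia.
  by rewrite inE mem_iota => /eqP ->; lia.
do 3 (apply: run_seq; apply: (step _ _ _) => // ?).
by apply: step.
Qed.

(** * The program *)

(* Arrays:
     0-3    for each direction, the inverse of the coordinate of [pi];
     4-7    the same for [sigma];
     8-11   the predecessors in [sigma];
     12-15  the sides of the boxes being propagated;
     16-19  the sides of the boxes accepted so far;
     20     the class of every point of [pi];
     21     the class assigned to every element of [sigma];
     22     the stack, from index 1.
   Registers: 0 answer, 1 base of the arrays, 2-4 the sizes l, n, t, 5-7 loop
   counters, 8 size of the stack, 9 success flag, 10-12 suspect, side and point
   under test, 13 main loop flag, 14 carry, 15-17 reading of the classes. *)
Definition crdE off sz d e :=
  let x := Fetch (Op Add off (Op Add (Op Mul (Const 2) e) (Const (1 < d)))) in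
  if odd d then Op Defs.Sub (Op Add (Reg sz) (Const 1)) x else x.

Definition points_at s off p :=
  off + 2 * len p + 1 < reg s 1 /\
  forall i, 0 < i <= len p ->
    cell s (off + 2 * i) = crd p 0 i /\ cell s (off + (2 * i).+1) = crd p 2 i.

Lemma den_crdE s off sz p d e : points_at s (den s off) p -> reg s sz = len p ->
  d < 4 -> 0 < den s e <= len p -> den s (crdE off sz d e) = crd p d (den s e).
Proof.
move=> [_ h] hsz hd he; have [h0 h2] := h _ he.
case: d hd => [|[|[|[|d]]]] //= _; rewrite ?addn0 ?addn1 ?h0 ?h2 ?hsz //=.
Qed.

Lemma points_at_frame s s' rs js off p : 1 \notin rs -> frame rs js s s' ->
  points_at s off p -> points_at s' off p.
Proof.
move=> h1 [a b c] [d e]; split; first by rewrite a.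
by move=> i hi; have [h0 h2] := e i hi; rewrite !b ?h0 ?h2 //; lia.
Qed.

Definition offS := Const 1.
Definition offP := Op Add (Const 1) (Op Mul (Const 2) (Reg 2)).

Definition lowE d := Op Lt (ld (12 + d) (ld (8 + d) (Reg 10))) (Reg 11).
Definition classE := Op Eq (ld 20 (Reg 12)) (ld 21 (Reg 10)).
Definition belowE e := Op Lt (crdE offP 3 e (Reg 12)) (ld (12 + e) (Reg 10)).

(** Without boolean operations, a sum being nonzero serves as disjunction and subtraction from 1 as
    negation. *)
Definition fireE d :=
  Op Add (Op Defs.Sub (Const 1) (lowE d))
  (Op Add (Op Defs.Sub (Const 1) classE)
  (Op Add (belowE 0) (Op Add (belowE 1) (Op Add (belowE 2) (belowE 3))))).

Lemma sum_bool_neq0 (a b : bool) (c : nat -> bool) :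
  ((1 - a) + ((1 - b) + (c 0 + (c 1 + (c 2 + c 3)))) != 0) =
  [|| ~~ a, ~~ b | has c (iota 0 4)].
Proof.
rewrite [has _ _]/= orbF; case: a; case: b => //.
by case: (c 0); case: (c 1); case: (c 2); case: (c 3).
Qed.

Lemma den_fireE s d : den s (fireE d) =
  (1 - den s (lowE d)) + ((1 - den s classE) + (den s (belowE 0) +
  (den s (belowE 1) + (den s (belowE 2) + den s (belowE 3))))).
Proof. by []. Qed.

(* A side that cannot be raised refutes the box: clear the flag and the stack. *)
Definition bumpC d :=
  Seq (Store (arr (12 + d) (Reg 10)) (Op Add (Reg 11) (Const 1)))
  (If (Op Lt (Reg 11) (Reg 3))
     (Seq (Assign 12 (ld (8 + opp d) (Reg 10)))
        (If (Reg 12)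
           (Seq (Assign 8 (Op Add (Reg 8) (Const 1)))
                (Store (arr 22 (Reg 8)) (Reg 12)))
           Skip))
     (Seq (Assign 9 (Const 0)) (Assign 8 (Const 0)))).

(** Only the first side that fires is raised. The suspect stays on the stack and is popped once no
    side fires. *)
Definition chain ds :=
  foldr (fun d c =>
    Seq (Assign 11 (ld (12 + d) (Reg 10)))
   (Seq (Assign 12 (ld d (Reg 11)))
        (If (fireE d) (bumpC d) c)))
   (Assign 8 (Op Defs.Sub (Reg 8) (Const 1))) ds.

Definition step := Seq (Assign 10 (ld 22 (Reg 8))) (chain [:: 0; 1; 2; 3]).

Definition propagate := While (Reg 8) step.

(** The number of raises still possible before all sides reach [n]. *)
Definition pot l n (B : nat -> nat -> nat) := \sum_(d < 4) \sum_(i < l) (n - B d i.+1).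

Lemma pot_raise l n B B' d i : d < 4 -> 0 < i <= l -> B d i < n ->
  (forall d' i', d' < 4 -> B' d' i' = raise B d i d' i') ->
  (pot l n B').+1 = pot l n B.
Proof.
move=> hd hi hn E; rewrite /pot.
rewrite (bigD1 (Ordinal hd)) //= [in RHS](bigD1 (Ordinal hd)) //=.
have hi' : i.-1 < l by lia.
rewrite (bigD1 (Ordinal hi')) //= [in RHS](bigD1 (Ordinal hi')) //=.
have -> : i.-1.+1 = i by lia.
rewrite E // /raise !eqxx /=.
rewrite (eq_bigr (fun i' : 'I_l => n - B d i'.+1)); last first.
  move=> j /negP hj; rewrite E // /raise eqxx /= ifF //; apply/eqP => ?.
  by apply: hj; apply/eqP/val_inj => /=; lia.
rewrite (eq_bigr (fun d' : 'I_4 => \sum_(i < l) (n - B d' i.+1))); last first.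
  move=> d' /negP hd'; apply: eq_bigr => j _; rewrite E // /raise ifF //.
  by apply/negP => /andP [/eqP h _]; apply: hd'; apply/eqP/val_inj.
by rewrite -!addnA -addSn; congr (_ + _); lia.
Qed.

Lemma pot_le l n B : pot l n B <= 4 * l * n.
Proof.
rewrite /pot; have h (d : 'I_4) : \sum_(i < l) (n - B d i.+1) <= l * n.
  rewrite -[l in l * n]card_ord -sum_nat_const; apply: leq_sum => i _; exact: leq_subr.
rewrite -mulnA -[4 in X in _ <= X]card_ord -sum_nat_const; apply: leq_sum => i _; exact: h.
Qed.

Section Program.
Variables (t : nat) (sigma pi : lpoints) (Pi : t.-tuple {fset nat}).
Hypotheses (reds : reduced sigma) (redp : reduced pi).

Notation l := (len sigma).
Notation n := (len pi).
Notation sol G := (solution l n (pred_in sigma) (crd pi) (class_of Pi) G).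
Notation inbox := (in_box l (crd pi)).
Notation fire G := (fires (pred_in sigma) (crd pi) (crd_inv pi) (class_of Pi) G).
Notation consist G := (consistent l n (pred_in sigma) (crd pi) (crd_inv pi) (class_of Pi) G).

Hypotheses (l_gt0 : 0 < l) (n_gt0 : 0 < n) (M_big : 9 * l * n + t + n < M).

Lemma l_le_M : l <= M.
Proof. by have : l * 1 <= l * n; [rewrite leq_mul2l n_gt0 orbT|lia]. Qed.

Definition ready s :=
  [/\ [/\ reg s 2 = l, reg s 3 = n & reg s 4 = t],
      points_at s 1 sigma, points_at s (1 + 2 * l) pi,
      forall d, d < 4 -> (forall b, 0 < b <= n -> elt s d b = crd_inv pi d b) /\
                         (forall i, 0 < i <= l -> elt s (8 + d) i = pred_in sigma d i) &
      forall q, 0 < q <= n -> elt s 20 q = class_of Pi q].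

Lemma ready_frame rs js s s' : frame rs js s s' ->
  all (fun r => r \notin rs) [:: 1; 2; 3; 4] ->
  all (fun j => j \notin js) [:: 0; 1; 2; 3; 8; 9; 10; 11; 20] -> ready s -> ready s'.
Proof.
move=> hf /and5P [r1 r2 r3 r4 _] /allP hj [[e2 e3 e4] p1 p2 htab hc].
have [a b c] := hf; split.
- by rewrite !a.
- exact: points_at_frame hf _.
- exact: points_at_frame hf _.
- move=> d hd; have [h1 h2] := htab d hd.
  split=> [x hx|x hx]; rewrite c ?h1 ?h2 //; [by lia|apply: hj|by lia|apply: hj].
    by case: d hd {h1 h2} => [|[|[|[|]]]].
  by case: d hd {h1 h2} => [|[|[|[|]]]].
- by move=> q hq; rewrite c ?hc //; apply: hj.
Qed.

Definition boxB s d i := elt s (12 + d) i.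

Lemma fires_ext G B B' d i : d < 4 ->
  (forall d' i', d' < 4 -> B d' i' = B' d' i') -> fire G B d i = fire G B' d i.
Proof.
move=> hd E; rewrite /fires !E //; congr [|| _, _ | _].
by apply: eq_in_has => e; rewrite mem_iota => he; rewrite E.
Qed.

Lemma fireE_fires G s d : ready s -> d < 4 -> 0 < reg s 10 <= l ->
  reg s 11 = boxB s d (reg s 10) -> 0 < boxB s d (reg s 10) <= n ->
  reg s 12 = crd_inv pi d (boxB s d (reg s 10)) ->
  elt s 21 (reg s 10) = G (reg s 10) ->
  (den s (fireE d) != 0) = fire G (boxB s) d (reg s 10).
Proof.
move=> [[e2 e3 e4] _ hp htab hc] hd hv h11 hb h12 hG.
have hw : 0 < reg s 12 <= n by rewrite h12 crd_inv_range.
have below e : e < 4 ->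
    den s (belowE e) =
    (crd pi e (reg s 12) < boxB s e (reg s 10)) :> nat.
  by move=> he; rewrite /belowE /den -/den (@den_crdE _ _ _ pi) //= e2.
rewrite den_fireE !below //.
have -> : den s (lowE d) =
    (boxB s d (pred_in sigma d (reg s 10)) < boxB s d (reg s 10)) :> nat.
  by rewrite /= -/(elt s (8 + d) (reg s 10)) (htab d hd).2 // h11.
have -> : den s classE =
    (class_of Pi (reg s 12) == G (reg s 10)) :> nat.
  by rewrite /= -/(elt s 20 (reg s 12)) -/(elt s 21 (reg s 10)) hc // hG.
rewrite (sum_bool_neq0 _ _ (fun e => crd pi e (reg s 12) < boxB s e (reg s 10))).
by rewrite /fires -h12 -leqNgt.
Qed.

(** * Correctness and amortized cost of the propagation *)

Section Propagation.
Variables (G : nat -> nat) (B0 : nat -> nat -> nat).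

(* [m] bounds the number of remaining steps: a step either pops the stack, or
   raises a side and pushes at most one suspect. *)
Definition live m s :=
  [/\ ready s /\ (forall i, 0 < i <= l -> elt s 21 i = G i),
      [/\ m <= 9 * l * n, reg s 9 = 1 & reg s 8 + 2 * pot l n (boxB s) <= m],
      [/\ box_ok l n (boxB s), forall d i, d < 4 -> 0 < i <= l -> B0 d i <= boxB s d i &
          forall k, 0 < k <= reg s 8 -> 0 < elt s 22 k <= l],
      forall f, sol G f -> inbox B0 f -> inbox (boxB s) f &
      forall i, 0 < i <= l -> (exists2 k, 0 < k <= reg s 8 & elt s 22 k = i) \/
        forall d, d < 4 -> ~~ fire G (boxB s) d i].

Definition dead (s : state) :=
  [/\ ready s /\ (forall i, 0 < i <= l -> elt s 21 i = G i),
     reg s 9 = 0, reg s 8 = 0 & forall f, sol G f -> ~ inbox B0 f].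

Definition pinv m s := live m s \/ dead s.

(** A raise frees two units of the budget, and a push takes back one at most. Only [v], still on the
    stack, and its successor in direction [d] may acquire new refutations. *)
Lemma bump_run m s d v : live m s -> d < 4 -> 0 < reg s 8 -> elt s 22 (reg s 8) = v ->
  reg s 10 = v -> reg s 11 = boxB s d v -> fire G (boxB s) d v ->
  run (bumpC d) s (tcost (bumpC d)) (fun s' => exists2 m', m' < m & pinv m' s').
Proof.
move=> hl hd h8 hst h10 h11 hf.
have [[hr hG] [hm h9 hpot] [hB hge hstk] hsol hcov] := hl.
have hv : 0 < v <= l by rewrite -hst hstk // h8 leqnn.
have hvn : 0 < boxB s d v <= n by have [_ ->] := hB d hd.
apply: run_seq; apply: run_store_arr => //.
- by clear -hd; case: d hd => [|[|[|[|]]]].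
- by move=> _; rewrite /= h11; lia.
set s1 := set_elt _ _ _ _.
have f1 : frame [::] [:: 12 + d] s s1 by apply: frame_set_elt; lia.
have hbump d' i' : d' < 4 -> boxB s1 d' i' = raise (boxB s) d v d' i'.
  move=> hd'; rewrite /boxB elt_set_elt ?eqn_add2l /=; [|lia|lia].
  by rewrite /raise h10 h11 addn1.
have hr1 : ready s1.
  apply: ready_frame f1 _ _ hr => //.
  by clear -hd; case: d hd => [|[|[|[|]]]].
have hG1 i : 0 < i <= l -> elt s1 21 i = G i.
  by move=> hi; have [_ _ ->] := f1; rewrite ?hG // inE; lia.
have [[e2 e3 e4] _ _ htab _] := hr1.
have snd f : sol G f -> inbox B0 f -> boxB s d v < crd pi d (f v).
  move=> h1 h2; apply: (fires_sound _ _ _ hB h1) hf => //; last exact: hsol.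
  - by move=> *; exact: crd_range.
  - by move=> *; exact: crdK.
  - by move=> *; exact: pred_in_range.
apply: run_if => //=; rewrite -[reg s1 _]/(reg s 11) h11 e3; last first.
  (* The refuted side is already [n]: a solution would need a larger coordinate, so none is left in
     the boxes [B0]. *)
  move=> h; have hn : boxB s d v = n by case: ltnP h; lia.
  apply: run_seq; apply: run_assign => //; apply: run_assign => //=.
  exists 0; first by lia.
  right; split=> //=.
  move=> f h1 h2; have := snd f h1 h2; have [fr _ _] := h1 v hv.
  by have := crd_range redp hd fr; rewrite hn; lia.
move=> h; have {h} hlt : boxB s d v < n by case: ltnP h.
have o4 : opp d < 4 by clear -hd; case: d hd => [|[|[|[|]]]].
apply: run_seq; apply: run_assign.
- by clear -hd; case: d hd => [|[|[|[|]]]].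
- by move=> [_ hb] /=; exact: hb.
set w := pred_in sigma (opp d) v.
have -> : den s1 (ld (8 + opp d) (Reg 10)) = w by rewrite /w -(htab _ o4).2 // -h10.
have hwl : w <= l by exact: pred_in_range.
have hp := pot_raise hd hv hlt hbump.
have hB1 : box_ok l n (boxB s1).
  move=> d' hd'; have [b0 b1] := hB d' hd'; split=> [|i hi].
    by rewrite hbump // /raise; case: ifP => // /andP [_ /eqP ?]; lia.
  by rewrite hbump // /raise; case: ifP => // _; exact: b1.
have hge1 d' i : d' < 4 -> 0 < i <= l -> B0 d' i <= boxB s1 d' i.
  move=> hd' hi; rewrite hbump // /raise; case: ifP => [/andP [/eqP-> /eqP->]|_]; last exact: hge.
  by apply: leqW; exact: hge.
have hsol1 f : sol G f -> inbox B0 f -> inbox (boxB s1) f.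
  move=> h1 h2 d' i hd' hi; rewrite hbump // /raise.
  case: ifP => [/andP [/eqP-> /eqP->]|_]; [exact: snd|exact: hsol].
have hcov1 i : 0 < i <= l -> i != w ->
    (exists2 k, 0 < k <= reg s 8 & elt s 22 k = i) \/
    forall d, d < 4 -> ~~ fire G (boxB s1) d i.
  move=> hi iw; have [->|iv] := eqVneq i v.
    by left; exists (reg s 8) => //; lia.
  have [[k hk E]|hq] := hcov i hi; first by left; exists k.
  right=> d' hd'; rewrite (fires_ext G (B' := raise (boxB s) d v)) //.
  rewrite (raise_fires (l := l)) ?hq //.
  by move=> *; exact: pred_in_opp.
have hst1 k : elt s1 22 k = elt s 22 k.
  by have [_ _ ->] := f1; rewrite // inE; lia.
set s2 := set_reg _ _ _.
apply: run_if => // [h|h].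
  have hw0 : 0 < w by rewrite lt0n; apply/eqP.
  apply: run_seq; apply: run_assign => //.
    by move=> _; change (reg s 8 + 1 <= M); lia.
  apply: run_store_arr => //.
    by move=> _; change (w <= M); have := l_le_M; lia.
  set s3 := set_elt _ _ _ _.
  have f3 : frame [:: 8; 12] [:: 22] s1 s3.
    by apply: frame_elt => //; apply: frame_reg => //; apply: frame_reg.
  exists m.-1; first by lia.
  left; have [_ _ g3] := f3.
  have Ebox d' i' : d' < 4 -> boxB s3 d' i' = boxB s1 d' i'.
    by move=> hd'; apply: g3; rewrite ?inE; lia.
  have r8 : reg s3 8 = (reg s 8).+1 by exact: addn1.
  have E22 k : elt s3 22 k = if k == (reg s 8).+1 then w else elt s 22 k.
    rewrite -hst1 -[(reg s 8).+1]addn1.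
    exact: (@elt_set_elt _ 22 _ _ 22 k isT isT).
  split.
  - split; first by apply: ready_frame f3 _ _ hr1.
    by move=> i hi; rewrite g3 ?hG1.
  - split=> //; first by lia.
    have -> : pot l n (boxB s3) = pot l n (boxB s1).
      by apply: eq_bigr => d' _; apply: eq_bigr => i' _; rewrite Ebox.
    by rewrite r8; lia.
  - split.
    + by move=> d' hd'; have [b0 b1] := hB1 d' hd'; split=> [|i hi]; rewrite Ebox ?b1.
    + by move=> d' i hd' hi; rewrite Ebox ?hge1.
    + move=> k; rewrite r8 E22 => hk; case: eqP => [_|?]; first by lia.
      by apply: hstk; lia.
  - by move=> f h1 h2 d' i hd' hi; rewrite Ebox //; apply: hsol1.
  - move=> i hi; have [iw|iw] := eqVneq i w.
      by left; exists (reg s 8).+1; rewrite ?r8 ?E22 ?eqxx //; lia.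
    have [[k hk E]|hq] := hcov1 i hi iw.
      by left; exists k; rewrite ?r8 ?E22; [lia|case: eqP => //; lia].
    by right=> d' hd'; rewrite (fires_ext G (B' := boxB s1)) ?hq.
apply: run_skip; exists m.-1; first by lia.
left; split=> //.
- by split=> //; [lia|rewrite -[reg s2 8]/(reg s 8) -[boxB s2]/(boxB s1); lia].
- by split=> // k hk; rewrite -[elt s2 22 k]/(elt s1 22 k) hst1; apply: hstk.
(* There is nothing to push: [w] is 0, which is not an element, so [hcov1] covers every element. *)
- move=> i hi; have iw : i != w by rewrite (_ : w = 0) //; lia.
  have [[k hk E]|hq] := hcov1 i hi iw; last by right.
  by left; exists k; rewrite -?[elt s2 22 k]/(elt s1 22 k) ?hst1.
Qed.

(** The directions missing from [ds] are those already found quiet. When [ds] is empty, [v] needs no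
    place on the stack any more. *)
Lemma chain_run m s v ds : live m s -> 0 < reg s 8 -> elt s 22 (reg s 8) = v ->
  reg s 10 = v -> (forall d, d \in ds -> d < 4) ->
  (forall d, d < 4 -> d \notin ds -> ~~ fire G (boxB s) d v) ->
  run (chain ds) s (tcost (chain ds)) (fun s' => exists2 m', m' < m & pinv m' s').
Proof.
elim: ds s => [|d ds IH] s hl h8 hst h10 hds hq.
  have [[hr hG] [hm h9 hpot] [hB hge hstk] hsol hcov] := hl.
  apply: run_assign => //=; first by lia.
  exists m.-1; first by lia.
  left; split=> //.
  - split=> //; first by lia.
    by rewrite /= /upd /= -[boxB _]/(boxB s); lia.
  - by split=> //= k; rewrite /= /upd /= => hk; apply: hstk; lia.
  - move=> i hi; have [[k hk E]|?] := hcov i hi; last by right.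
    have [Ek|nk] := eqVneq k (reg s 8).
      by right=> d hd; rewrite -E Ek hst; apply: hq.
    by left; exists k => //=; rewrite /upd /=; lia.
have [[hr hG] [hm h9 hpot] [hB hge hstk] hsol hcov] := hl.
have hd : d < 4 by apply: hds; rewrite inE eqxx.
have hv : 0 < v <= l by rewrite -hst; apply: hstk; lia.
have hvn : 0 < boxB s d v <= n by have [_ ->] := hB d hd.
rewrite [chain _]/=; apply: run_seq; apply: run_assign => //.
- by clear -hd; case: d hd => [|[|[|[|]]]].
- by move=> [_ hb]; exact: hb.
set s1 := set_reg _ _ _; apply: run_seq; apply: run_assign => //.
- by clear -hd; case: d hd => [|[|[|[|]]]].
- by move=> [_ hb]; exact: hb.
set s2 := set_reg _ _ _.
have e11 : reg s2 11 = boxB s d v by rewrite -h10.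
have e12 : reg s2 12 = crd_inv pi d (boxB s d v).
  have [_ _ _ htab _] := hr; have [<- // _] := htab d hd.
  by rewrite -e11.
have hf : (den s2 (fireE d) != 0) = fire G (boxB s) d v.
  rewrite -h10; apply: (fireE_fires (s := s2)) => //; rewrite -?[reg s2 10]/(reg s 10) h10 //.
  exact: hG.
apply: run_if => [|hn|h0].
- by clear -hd; case: d hd => [|[|[|[|]]]].
- by apply: (@bump_run m s2 d v) => //; rewrite -hf; apply/eqP.
- apply: (IH s2) => // d' hd'; first by apply: hds; rewrite inE hd' orbT.
  move=> hn; have [->|ne] := eqVneq d' d; first by rewrite -hf h0.
  by apply: hq => //; rewrite inE negb_or ne.
Qed.

Lemma step_run m s : pinv m s -> reg s 8 <> 0 ->
  run step s (tcost step) (fun s' => exists2 m', m' < m & pinv m' s').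
Proof.
case=> [hl|[_ _ -> _] //] h8; rewrite /step.
have [_ _ [_ _ hstk] _ _] := hl.
apply: run_seq; apply: run_assign => //; first by move=> [_ hb]; exact: hb.
apply: (@chain_run m _ (elt s 22 (reg s 8))) => //=.
- by rewrite /upd /=; lia.
- by move=> d; rewrite !inE => /or4P [] /eqP ->.
- by move=> d hd; rewrite !inE; case: d hd => [|[|[|[|]]]].
Qed.

Lemma propagate_run m s : pinv m s ->
  run propagate s (2 + m * (1 + tcost step).+1)
    (fun s' => [/\ ready s', forall i, 0 < i <= l -> elt s' 21 i = G i &
       [/\ reg s' 9 = 1, consist G (boxB s') &
           forall d i, d < 4 -> 0 < i <= l -> B0 d i <= boxB s' d i] \/
       (reg s' 9 = 0 /\ forall f, sol G f -> ~ inbox B0 f)]).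
Proof.
move=> hI; apply: (run_while (e := Reg 8) _ hI) => // {hI m s} [m s hI h8|m s].
  exact: step_run hI h8.
case=> [[[hr hG] [hm h9 hpot] [hB hge hstk] hsol hcov] /= h8|[[hr hG] h9 h8 hn] _].
  split=> //; left; split=> //; split=> // d i hd hi.
  by have [[k hk]|hq] := hcov i hi; [lia|exact: hq].
by split=> //; right.
Qed.

End Propagation.

(** * Trying one point for one element *)

Definition zeroB := each (fun d => Store (arr (12 + d) (Const 0)) (Const 0)).
Definition copyB := each (fun d => Store (arr (12 + d) (Reg 7)) (ld (16 + d) (Reg 7))).
Definition fixB := each (fun d => Store (arr (12 + d) (Reg 5)) (crdE offP 3 d (Reg 6))).
Definition commitB := each (fun d => Store (arr (16 + d) (Reg 7)) (ld (12 + d) (Reg 7))).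

(** The work is done on a copy, so a failure leaves the accepted boxes intact. [zeroB] sets the side
    of the missing predecessor. *)
Definition trial :=
  Seq zeroB
 (Seq (For 7 2 (Seq copyB (Store (arr 22 (Reg 7)) (Reg 7))))
 (Seq fixB
 (Seq (Assign 8 (Reg 2))
 (Seq (Assign 9 (Const 1))
 (Seq propagate
      (If (Reg 9) (For 7 2 commitB) Skip)))))).

(** Cell 0 of the arrays 16 to 19 is never written; the value that [box_ok] requires there is put in
    by hand. *)
Definition boxC s d i := if i == 0 then 0 else elt s (16 + d) i.

Definition trial_const :=
  20 * (tcost zeroB + tcost copyB + tcost fixB + tcost step + tcost commitB + 10).

Lemma consist_ext G B B' :
  (forall d i, d < 4 -> i <= l -> B d i = B' d i) -> consist G B -> consist G B'.
Proof.
move=> E [h1 h2]; split=> [d hd|d i hd hi].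
  by have [b0 b1] := h1 d hd; split=> [|i hi]; rewrite -E ?b1 //; lia.
have := h2 d i hd hi; rewrite /fires !E //; last first.
- by lia.
- by exact: pred_in_range.
congr (~~ [|| _, _ | _]).
by apply: eq_in_has => e; rewrite mem_iota => he; rewrite E //; lia.
Qed.

(** On success the sides of [i] are not compared with the earlier ones: its box was replaced by [q],
    not intersected with it. *)
Lemma trial_run G s i q : ready s -> (forall i, 0 < i <= l -> elt s 21 i = G i) ->
  0 < i <= l -> 0 < q <= n -> reg s 5 = i -> reg s 6 = q ->
  (forall d j, d < 4 -> 0 < j <= l -> 0 < elt s (16 + d) j <= n) ->
  run trial s (l * n * trial_const)
    (fun s' =>
      [/\ reg s' 9 = 1, consist G (boxC s'),
        (forall d j, d < 4 -> 0 < j <= l -> j != i -> elt s (16 + d) j <= elt s' (16 + d) j) &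
        (forall d, d < 4 -> crd pi d q <= elt s' (16 + d) i)] \/
      [/\ reg s' 9 = 0,
        (forall d j, d < 4 -> 0 < j <= l -> elt s' (16 + d) j = elt s (16 + d) j) &
        forall f, sol G f -> f i = q -> ~ inbox (boxC s) f]).
Proof.
move=> hr hG hi hq h5 h6 hC; have [[e2 e3 e4] _ _ _ _] := hr.
have q4 d : d < 4 -> 0 < crd pi d q <= n by move=> hd; exact: crd_range.
have lM := l_le_M.
rewrite /trial.
eapply run_le; first last.
- by move=> s' h; exact: h.
- shelve.
apply: run_seq; apply: (@run_each _ 12 (fun=> Const 0) (fun=> Const 0) (fun=> 0) (fun=> 0)) => //.
  by case=> [|[|[|[|]]]].
set s1 := set4 _ _ _ _.
have f1 : frame [::] (iota 12 4) s s1 by exact: frame_set4.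
have z1 d : d < 4 -> elt s1 (12 + d) 0 = 0.
  by move=> hd; rewrite elt_set4 //; [case: ifP => //|]; lia.
pose rj := [:: 7]. pose js := [:: 12; 13; 14; 15; 22].
pose I k s' := [/\ frame rj js s s', forall d, d < 4 -> elt s' (12 + d) 0 = 0 &
  forall j, 0 < j <= k -> (forall d, d < 4 -> elt s' (12 + d) j = elt s (16 + d) j) /\
    elt s' 22 j = j].
apply: run_seq; eapply run_le; [|exact: leqnn|].
  apply: (@run_for 7 2 _ I l) => //.
    split=> //; last by move=> j; lia.
    apply: frame_reg => //; apply: frame_sub f1 => // x.
    by rewrite mem_iota !inE; lia.
  move=> k s2 hk [f2 z2 c2] r7 r2.
  apply: run_seq; apply: (@run_each _ 12 (fun=> Reg 7) _ (fun=> k.+1) (fun d => elt s (16 + d) k.+1)) => //.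
  - by case=> [|[|[|[|]]]].
  - by move=> _ d hd; have := hC d k.+1 hd; lia.
  - move=> d s3 hd f3; have [g1 g2 g3] := f3; have [g1' g2' g3'] := f2.
    split; first by rewrite /= g1.
    rewrite -[den _ _]/(elt s3 (16 + d) (reg s3 7)) g1 // g3; [|lia|by rewrite mem_iota; lia].
    rewrite -[elt _ _ _]/(elt s2 (16 + d) k.+1) g3'; [by []|lia|by rewrite !inE; lia].
  set s3 := set4 _ _ _ _.
  apply: run_store_arr => //; first by move=> _ /=; rewrite /upd /=; lia.
  set s4 := set_elt _ _ _ _.
  have f4 : frame rj js s s4.
    apply: frame_elt => //.
    apply: (@frame_trans _ _ _ (set_reg s2 7 k.+1)) => //; first exact: frame_reg.
    by apply: frame_sub (frame_set4 _ _ _ _) => // x; rewrite mem_iota !inE; lia.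
  have E4 d j : d < 4 -> elt s4 (12 + d) j =
      if j == k.+1 then elt s (16 + d) k.+1 else elt s2 (12 + d) j.
    move=> hd; rewrite elt_set_elt //; last by lia.
    rewrite ifF; last by lia.
    rewrite elt_set4 //; last by lia.
    by rewrite addKn; case: eqP => _; [rewrite ifT|rewrite ifF] => //; lia.
  have E5 j : elt s4 22 j = if j == k.+1 then k.+1 else elt s2 22 j.
    by rewrite elt_set_elt // eqxx andTb [elt s3 _ _]elt_set4.
  split=> // [d hd|j hj]; first by rewrite E4 //= z2.
  rewrite E5; have [->|ne] := eqVneq j k.+1; first by split=> // d hd; rewrite E4 ?eqxx.
  have [c3 c4] := c2 j ltac:(lia); split=> // d hd; rewrite E4 // (negPf ne); exact: c3.
move=> s2 [_ [f2 z2 c2]]; have [a2 b2 g2] := f2.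
have hr2 : ready s2 by apply: ready_frame f2 _ _ hr.
have [[_ _ _] _ p2 _ _] := hr2.
apply: run_seq; apply: (@run_each _ 12 (fun=> Reg 5) _ (fun=> i) (fun d => crd pi d q)) => //.
- by case=> [|[|[|[|]]]].
- by move=> _ d hd; have := q4 d hd; lia.
- move=> d s3 hd f3; have [a3 b3 g3] := f3.
  have h6' : reg s3 6 = q by rewrite a3 // a2.
  split; first by rewrite /= a3 // a2.
  rewrite (@den_crdE _ _ _ pi) //= ?h6' //; last by rewrite a3 // a2.
  by rewrite a3 // a2 // e2; exact: points_at_frame f3 p2.
set s3 := set4 _ _ _ _.
have f3 : frame rj js s s3.
  apply: (frame_trans _ f2) => //.
  by apply: frame_sub (frame_set4 _ _ _ _) => // x; rewrite mem_iota !inE; lia.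
have E3 d j : d < 4 -> elt s3 (12 + d) j = if j == i then crd pi d q else elt s2 (12 + d) j.
  move=> hd; rewrite elt_set4 //; last by lia.
  by rewrite addKn; case: eqP => _; [rewrite ifT|rewrite ifF] => //; lia.
have E3' j : elt s3 22 j = elt s2 22 j by rewrite elt_set4.
apply: run_seq; apply: run_assign => //; first by move=> _ /=; rewrite a2 // e2.
apply: run_seq; apply: run_assign => //.
set s4 := set_reg _ _ _.
have f4 : frame [:: 7; 8; 9] js s s4.
  by do 2 apply: frame_reg => //; apply: frame_sub f3 => // x; rewrite !inE => ->.
have hr4 : ready s4 by apply: ready_frame f4 _ _ hr.
(* All [l] elements are suspects and the potential is at most [4 * l * n]; the budget is [l * n] for
   the former plus twice the latter. *)
have live4 : live G (boxB s3) (9 * l * n) s4.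
  have r8 : reg s4 8 = l by rewrite -e2 -[RHS]a2.
  split.
  - by split=> // j hj; have [_ _ ->] := f4; rewrite ?hG.
  - split=> //; rewrite r8 -[boxB s4]/(boxB s3).
    have := pot_le l n (boxB s3); have : l <= l * n by rewrite leq_pmulr.
    by lia.
  - split=> // [d hd|k].
      split; first by rewrite -[boxB _ _ _]/(elt s3 (12 + d) 0) E3 // ifF ?z2 //; lia.
      move=> j hj; rewrite -[boxB _ _ _]/(elt s3 (12 + d) j) E3 //.
      have [c3 _] := c2 j hj; rewrite c3 //.
      by case: ifP => _; [exact: q4|exact: hC].
    rewrite r8 -[elt s4 _ _]/(elt s3 22 k) E3' => hk.
    by have [_ ->] := c2 k hk.
  - by [].
  - move=> j hj; left; exists j; first by rewrite r8.
    by rewrite -[elt s4 _ _]/(elt s3 22 j) E3'; have [_ ->] := c2 j hj.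
apply: run_seq; eapply run_le; [|exact: leqnn|].
  apply: (run_frame (c := propagate)) => //.
  by apply: (propagate_run (or_introl live4)).
move=> s5 [f5 [hr5 hG5 hres]].
have f45 d j : d < 4 -> elt s5 (16 + d) j = elt s (16 + d) j.
  move=> hd; have [_ _ ->] := f5; [|lia|by clear -hd; case: d hd => [|[|[|[|]]]]].
  have [_ _ -> //] := f4; first by lia.
  by clear -hd; case: d hd => [|[|[|[|]]]].
apply: run_if => // h9.
  have [[h1 hcon hge]|[h0 _]] := hres; last by [].
  have [[e2' _ _] _ _ _ _] := hr5.
  pose J k s' := [/\ reg s' 9 = 1, forall d j, d < 4 -> elt s' (12 + d) j = elt s5 (12 + d) j &
    forall d j, d < 4 -> 0 < j <= k -> elt s' (16 + d) j = elt s5 (12 + d) j].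
  eapply run_le; [|exact: leqnn|].
    apply: (@run_for 7 2 _ J l) => //.
      by split=> // d j _ hj; lia.
    move=> k s6 hk [k9 k12 k16] r7 r2.
    apply: (@run_each _ 16 (fun=> Reg 7) _ (fun=> k.+1) (fun d => elt s5 (12 + d) k.+1)) => //.
    - by case=> [|[|[|[|]]]].
    - by move=> [_ _] d hd; have [hBo _] := hcon; have [_ /(_ k.+1 hk)] := hBo d hd; rewrite /boxB; lia.
    - move=> d s7 hd f7; have [a7 b7 g7] := f7; split; first by rewrite /= a7.
      rewrite -[den _ _]/(elt s7 (12 + d) (reg s7 7)) a7 // g7; [|lia|by rewrite mem_iota; lia].
      exact: k12.
    set s7 := set4 _ _ _ _.
    have f7 : frame [::] (iota 16 4) (set_reg s6 7 k.+1) s7 by exact: frame_set4.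
    have [a7 b7 g7] := f7.
    split; first by rewrite a7.
      by move=> d j hd; rewrite g7; [exact: k12|lia|by rewrite mem_iota; lia].
    move=> d j hd hj; rewrite elt_set4 //; last by lia.
    rewrite addKn; have [->|ne] := eqVneq j k.+1; first by rewrite ifT //; lia.
    by rewrite ifF; [apply: k16 => //|]; lia.
  move=> s6 [_ [k9 k12 k16]]; left; split=> //.
  - apply: (consist_ext _ hcon) => d j hd hj; rewrite /boxC; case: eqP => [->|nj].
      by have [hBo _] := hcon; have [-> _] := hBo d hd.
    by rewrite k16 //; lia.
  - move=> d j hd hj ji; rewrite k16 //; apply: leq_trans (hge d j hd hj).
    rewrite -[boxB _ _ _]/(elt s3 (12 + d) j) E3 // (negPf ji).
    by have [-> //] := c2 j hj.
  - move=> d hd; rewrite k16 //; apply: leq_trans (hge d i hd hi).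
    by rewrite -[boxB _ _ _]/(elt s3 (12 + d) i) E3 // eqxx.
have {}h9 : reg s5 9 = 0 by [].
apply: run_skip; right; split=> //.
  by move=> d j hd _; exact: f45.
have [[h1 _ _]|[_ hno]] := hres; first by rewrite h1 in h9.
move=> f hf fi hin; apply: (hno f hf) => d j hd hj.
rewrite -[boxB _ _ _]/(elt s3 (12 + d) j) E3 //; case: eqP => [->|_]; first by rewrite fi.
have [-> // _] := c2 j hj; have := hin d j hd hj; rewrite /boxC ifF //; lia.
Unshelve.
suff: tcost zeroB + (l * (tcost copyB + 9 + 8) + 6 + (tcost fixB + (2 + (2 +
    (2 + 9 * l * n * (1 + tcost step).+1 +
     (1 + maxn (l * (tcost commitB + 8) + 6) 1).+1))))) <= l * n * trial_const by [].
rewrite /trial_const; move: (tcost _) (tcost _) (tcost _) (tcost _) (tcost _) => a b c d e.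
(* As [l] and [n] are positive, constant terms and terms linear in [l] are absorbed by [l * n]. *)
have h1 x : x <= l * n * x by rewrite leq_pmull // muln_gt0 l_gt0.
have h2 x : l * x <= l * n * x by rewrite leq_mul2r leq_pmulr ?orbT.
move: (h1 a) (h1 b) (h1 c) (h1 d) (h1 e) (h1 1) (h2 a) (h2 b) (h2 c) (h2 d) (h2 e) (h2 1).
by rewrite !mulnDr; lia.
Qed.

(** * Deciding one assignment of classes without backtracking *)

Hypothesis mp : monotone_partition pi Pi.

(** Accepting boxes never loses solvability, even if the known solution lies outside them; a pinned
    element is never reconsidered. *)
Lemma clamp_solution G B f : consist G B -> sol G f -> exists2 f', sol G f' & inbox B f'.
Proof.
move=> hB hf; have := clamp_in_box _ _ _ _ _ _ (class_of_monotone redp mp) hB hf.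
case.
- by move=> *; exact: crd_inv_range.
- by move=> *; exact: crd_invK.
- by move=> *; exact: crdK.
- by move=> *; exact: crd_opp.
- by move=> *; exact: pred_in_range.
- by move=> *; exact: pred_in_opp.
by move=> h1 h2; exists (clamp (crd pi) (crd_inv pi) B f).
Qed.

Lemma consist_pinned_solution G B : consist G B ->
  (forall i, 0 < i <= l -> pinned n (crd pi) B i) -> exists f, sol G f.
Proof.
move=> hB hp; apply: pinned_solution hB hp.
- by move=> *; exact: crd_inv_range.
- by move=> *; exact: crd_invK.
- by move=> *; exact: crdK.
- by move=> *; exact: crd_opp.
- by move=> *; exact: pred_in_range.
Qed.

Definition initC := each (fun d => Store (arr (16 + d) (Reg 5)) (Const 1)).
(** Loops have no early exit: after a success the remaining iterations idle on the flag. *)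
Definition scan := For 6 3 (If (Reg 9) Skip trial).
Definition solve :=
  Seq (For 5 2 initC)
 (Seq (Assign 9 (Const 1))
      (For 5 2 (If (Reg 9) (Seq (Assign 9 (Const 0)) scan) Skip))).

Definition solve_regs := [:: 5; 6; 7; 8; 9; 10; 11; 12].
Definition solve_arrs := [:: 12; 13; 14; 15; 16; 17; 18; 19; 22].

Definition scan_const := trial_const + 20.

Lemma frame_ready_G G s s' : frame solve_regs solve_arrs s s' -> ready s ->
  (forall i, 0 < i <= l -> elt s 21 i = G i) ->
  ready s' /\ (forall i, 0 < i <= l -> elt s' 21 i = G i).
Proof.
move=> f hr hG; split; first exact: ready_frame f _ _ hr.
by move=> i hi; have [_ _ ->] := f; rewrite ?hG.
Qed.

Lemma scan_run G s i : ready s -> (forall i, 0 < i <= l -> elt s 21 i = G i) ->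
  0 < i <= l -> reg s 5 = i -> reg s 9 = 0 ->
  (forall d j, d < 4 -> 0 < j <= l -> 0 < elt s (16 + d) j <= n) ->
  run scan s (n * (l * n * scan_const))
    (fun s' => frame solve_regs solve_arrs s s' /\
      ([/\ reg s' 9 = 1, consist G (boxC s'),
        (forall d j, d < 4 -> 0 < j <= l -> j != i -> elt s (16 + d) j <= elt s' (16 + d) j) &
        pinned n (crd pi) (boxC s') i] \/
      (reg s' 9 = 0 /\ forall f, sol G f -> ~ inbox (boxC s) f))).
Proof.
move=> hr hG hi h5 h9 hC; have [[e2 e3 e4] _ _ _ _] := hr.
pose I k s' := frame solve_regs solve_arrs s s' /\
  ([/\ reg s' 9 = 1, consist G (boxC s'),
     (forall d j, d < 4 -> 0 < j <= l -> j != i -> elt s (16 + d) j <= elt s' (16 + d) j) &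
     pinned n (crd pi) (boxC s') i] \/
   [/\ reg s' 9 = 0, reg s' 5 = i,
     (forall d j, d < 4 -> 0 < j <= l -> elt s' (16 + d) j = elt s (16 + d) j) &
     forall f, sol G f -> 0 < f i <= k -> ~ inbox (boxC s) f]).
eapply run_le.
- apply: (@run_for 6 3 _ I n) => //.
    split; first exact: frame_reg.
    by right; split=> // f _; lia.
  move=> k s1 hk [f1 hd] r6 r3; have [hr1 hG1] := frame_ready_G f1 hr hG.
  have fk : frame solve_regs solve_arrs s (set_reg s1 6 k.+1) by exact: frame_reg.
  apply: run_if => // h.
    apply: run_skip; split=> //; left.
    by case: hd => [//|[h0 _ _ _]]; move: h; rewrite /= /upd /= h0.
  case: hd => [[h1 _ _ _]|[h0 h5' hC' hno]]; first by move: h; rewrite /= /upd /= h1.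
  eapply run_le; [|exact: leqnn|].
    apply: (run_frame (c := trial)) => //.
    apply: (@trial_run G _ i k.+1) => //.
    by move=> d j hd hj; rewrite -[elt _ _ _]/(elt s1 (16 + d) j) hC' ?hC.
  move=> s2 [f2 hd]; have fs : frame solve_regs solve_arrs s s2.
    by apply: (frame_trans _ fk) => //; apply: frame_sub f2; exact/allP.
  split=> //; case: hd => [[g9 gc gj gi]|[g9 gj gi]]; [left|right]; split=> //.
  - by move=> d j hd hj ji; rewrite -hC' //; exact: gj.
  - exists k.+1 => // d hd; rewrite /boxC ifF; [exact: gi|lia].
  - by have [a2 _ _] := f2; rewrite a2.
  - by move=> d j hd hj; rewrite gj // -hC'.
  - move=> f hf hfi hin; have [hfk|hfk] := eqVneq (f i) k.+1; last by apply: (hno f hf) => //; lia.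
    apply: (gi f hf hfk) => d j hd hj; have := hin d j hd hj; rewrite /boxC.
    by case: eqP => // _; rewrite -[elt (set_reg _ _ _) _ _]/(elt s1 (16 + d) j) hC'.
- suff: n * ((1 + maxn 1 (l * n * trial_const)).+1 + 8) + 6 <= n * (l * n * scan_const) by [].
  have x1 : 1 <= l * n by rewrite muln_gt0 l_gt0.
  have h : (1 + maxn 1 (l * n * trial_const)).+1 + 8 + 6 <= l * n * scan_const.
    by rewrite /scan_const; lia.
  have : n * ((1 + maxn 1 (l * n * trial_const)).+1 + 8 + 6) <= n * (l * n * scan_const).
    by rewrite leq_mul2l h orbT.
  by rewrite mulnDr; lia.
move=> s' [_ [fs hd]]; split=> //; case: hd => [[g9 gc gj gi]|[g9 g5 gC gn]]; [by left|right].
by split=> // f hf; apply: (gn f hf); have [] := hf i hi.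
Qed.

Definition solve_const := scan_const + tcost initC + 60.

(** While no scan has failed, a solvable assignment has a solution inside the accepted boxes, so one
    failed scan refutes the assignment. After [l] successes every box is pinned. *)
Lemma solve_run G s : ready s -> (forall i, 0 < i <= l -> elt s 21 i = G i) ->
  run solve s (l * (n * (l * n * solve_const)))
    (fun s' => frame solve_regs solve_arrs s s' /\
      ((reg s' 9 = 1 /\ exists f, sol G f) \/ (reg s' 9 = 0 /\ forall f, ~ sol G f))).
Proof.
move=> hr hG; have [[e2 e3 e4] _ _ _ _] := hr; have lM := l_le_M.
pose I0 k s' := frame solve_regs solve_arrs s s' /\
  forall d j, d < 4 -> 0 < j <= k -> elt s' (16 + d) j = 1.
(* The initial boxes are full but not propagated, hence consistency is only claimed after the first
   element. *)
pose I k s' := frame solve_regs solve_arrs s s' /\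
  ([/\ reg s' 9 = 1, forall d j, d < 4 -> 0 < j <= l -> 0 < elt s' (16 + d) j <= n,
      k = 0 \/ consist G (boxC s'), forall j, 0 < j <= k -> pinned n (crd pi) (boxC s') j &
      (exists f, sol G f) -> exists2 f, sol G f & inbox (boxC s') f] \/
   (reg s' 9 = 0 /\ forall f, ~ sol G f)).
eapply run_le.
- apply: run_seq; eapply run_le; [|exact: leqnn|].
    apply: (@run_for 5 2 _ I0 l) => //.
      by split; [exact: frame_reg|move=> d j _; lia].
    move=> k s1 hk [f1 h1] r5 r2.
    apply: (@run_each _ 16 (fun=> Reg 5) _ (fun=> k.+1) (fun=> 1)) => //.
    + by case=> [|[|[|[|]]]].
    + by move=> d s2 hd [a2 _ _]; split=> //; rewrite /= a2.
    split.
      apply: (@frame_trans _ _ _ (set_reg s1 5 k.+1)) => //; first exact: frame_reg.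
      by apply: frame_sub (frame_set4 _ _ _ _) => // x; rewrite mem_iota !inE; lia.
    move=> d j hd hj; rewrite elt_set4 //; last by lia.
    case: eqP => ?; first by rewrite ifT //; lia.
    by rewrite ifF; [apply: h1|]; lia.
  move=> s1 [_ [f1 h1]].
  apply: run_seq; apply: run_assign => //.
  have [a1 _ _] := f1.
  eapply run_le; [|exact: leqnn|].
    apply: (@run_for 5 2 _ I l) => //; first by rewrite -e2 -[RHS]a1.
      split; first by apply: frame_reg => //; apply: frame_reg.
      left; split=> //.
      - by move=> d j hd hj; rewrite -[elt _ _ _]/(elt s1 (16 + d) j) h1.
      - by left.
      - by move=> j; lia.
      - move=> [f hf]; exists f => // d j hd hj; rewrite /boxC ifF; last by lia.
        rewrite -[elt _ _ _]/(elt s1 (16 + d) j) h1 //.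
        by have [hfj _ _] := hf j hj; have := crd_range redp hd hfj; lia.
    move=> k s2 hk [f2 hd] r5 r2; have [hr2 hG2] := frame_ready_G f2 hr hG.
    have fk : frame solve_regs solve_arrs s (set_reg s2 5 k.+1) by exact: frame_reg.
    apply: run_if => // h; last first.
      apply: run_skip; split=> //; right.
      by case: hd => [[h9 _ _ _ _]|//]; move: h; rewrite /= /upd /= h9.
    case: hd => [[h9 hC hcon hpin hsol]|[h9 _]]; last by move: h; rewrite /= /upd /= h9.
    apply: run_seq; apply: run_assign => //.
    set s3 := set_reg _ _ _.
    have f3 : frame solve_regs solve_arrs s s3 by exact: frame_reg.
    have [hr3 hG3] := frame_ready_G f3 hr hG.
    eapply run_le; [|exact: leqnn|].
      by apply: (@scan_run G s3 k.+1).
    move=> s4 [f4 hd]; split; first exact: (frame_trans _ f3 f4).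
    case: hd => [[g9 gc gj gi]|[g9 gn]]; [left|right]; split=> //.
    - by move=> d j hd hj; have [/(_ d hd) [_ /(_ j hj)]] := gc; rewrite /boxC ifF //; lia.
    - by right.
    - move=> j hj; have [->//|ne] := eqVneq j k.+1.
      have [q hq hqb] := hpin j ltac:(lia); exists q => // d hd.
      have j0 : (j == 0) = false by lia.
      have := hqb d hd; rewrite /boxC j0 => hle; apply: leq_trans hle _.
      by apply: gj => //; lia.
    - by move=> [f hf]; exact: (clamp_solution gc hf).
    - by move=> f hf; have [f' h1' h2'] := hsol (ex_intro _ f hf); exact: (gn f' h1' h2').
  move=> s2 [_ [f2 hd]]; exact: (conj f2 hd).
- suff: l * (tcost initC + 8) + 6 + (2 +
     (l * ((1 + maxn (2 + n * (l * n * scan_const)) 1).+1 + 8) + 6)) <=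
     l * (n * (l * n * solve_const)) by [].
  have x1 : 1 <= l * n by rewrite muln_gt0 l_gt0.
  have h : (tcost initC + 8) + 6 + 2 + ((1 + maxn (2 + n * (l * n * scan_const)) 1).+1 + 8 + 6)
      <= n * (l * n * solve_const).
    have h2 x : x <= n * (l * n * x) by rewrite mulnA leq_pmull // muln_gt0 n_gt0.
    move: (h2 (tcost initC)) (h2 1).
    by rewrite /solve_const !mulnDr; lia.
  have : l * (tcost initC + 8 + 6 + 2 + ((1 + maxn (2 + n * (l * n * scan_const)) 1).+1 + 8 + 6))
     <= l * (n * (l * n * solve_const)) by rewrite leq_mul2l h orbT.
  move: (_.+1 + 8) (l * (n * _)) => b R; rewrite !mulnDr; lia.
move=> s' [fs hd]; split=> //; case: hd => [[g9 gC gcon gpin gsol]|]; [left|by right].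
split=> //; have {}gcon : consist G (boxC s') by case: gcon => // h; lia.
exact: (consist_pinned_solution gcon gpin).
Qed.

(** * Enumeration of the assignments *)

Definition carry_step :=
  If (Reg 14)
    (If (Op Lt (Op Add (ld 21 (Reg 5)) (Const 1)) (Reg 4))
       (Seq (Store (arr 21 (Reg 5)) (Op Add (ld 21 (Reg 5)) (Const 1)))
            (Assign 14 (Const 0)))
       (Store (arr 21 (Reg 5)) (Const 0)))
    Skip.

Definition incr :=
  Seq (Assign 14 (Const 1))
 (Seq (For 5 2 carry_step)
      (Assign 13 (Op Defs.Sub (Const 1) (Reg 14)))).

Definition digits s i := elt s 21 i.

Definition incr_const := tcost carry_step + 30.

Lemma incr_run s : ready s -> (forall i, 0 < i <= l -> digits s i < t) ->
  run incr s (l * incr_const)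
    (fun s' => [/\ frame [:: 5; 13; 14] [:: 21] s s',
        forall i, 0 < i <= l -> digits s' i < t &
        (reg s' 13 = 1 /\ (odo_val t (digits s) l).+1 = odo_val t (digits s') l) \/
        (reg s' 13 = 0 /\ t ^ l <= (odo_val t (digits s) l).+1)]).
Proof.
move=> hr hdig; have [[e2 e3 e4] _ _ _ _] := hr.
(* On the first [k] digits, the old value plus one equals the new value plus the carry times
   [t ^ k]. *)
pose I k s' := [/\ frame [:: 5; 13; 14] [:: 21] s s',
    forall i, 0 < i <= l -> digits s' i < t,
    forall i, k < i -> digits s' i = digits s i &
    (reg s' 14 = 1 /\ (odo_val t (digits s) k).+1 = odo_val t (digits s') k + t ^ k) \/
    (reg s' 14 = 0 /\ (odo_val t (digits s) k).+1 = odo_val t (digits s') k)].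
eapply run_leT.
- apply: run_seq; apply: run_assign => //.
  apply: run_seq; eapply run_le; [|exact: leqnn|].
    apply: (@run_for 5 2 _ I l) => //.
      split=> //; first by apply: frame_reg => //; exact: frame_reg.
      by left; rewrite /= expn0.
    move=> k s1 hk [f1 d1 q1 hc] r5 r2; have [a1 _ _] := f1.
    set s2 := set_reg s1 5 k.+1.
    have f2 : frame [:: 5; 13; 14] [:: 21] s s2 by exact: frame_reg.
    have ext s' : (forall i, i != k.+1 -> digits s' i = digits s2 i) ->
        odo_val t (digits s') k = odo_val t (digits s1) k.
      by move=> E; apply: odo_val_ext => i hi; rewrite E //; lia.
    have q2 : digits s2 k.+1 = digits s k.+1 by exact: q1.
    have dk : digits s k.+1 < t by apply: hdig; lia.
    apply: run_if => // h; last first.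
      apply: run_skip; have [[h14 _]|[h14 hv]] := hc; first by move: h; rewrite /= /upd /= h14.
      split=> // [i hi|]; first by apply: q1; lia.
      right; split=> //; change ((odo_val t (digits s) k).+1 + digits s k.+1 * t ^ k =
        odo_val t (digits s2) k + digits s2 k.+1 * t ^ k).
      by rewrite (ext s2) // q2 hv.
    have [[h14 hv]|[h14 _]] := hc; last by move: h; rewrite /= /upd /= h14.
    have Eset v i : digits (set_elt s2 21 k.+1 v) i = if i == k.+1 then v else digits s2 i.
      by rewrite /digits elt_set_elt.
    have fset v : frame [:: 5; 13; 14] [:: 21] s (set_elt s2 21 k.+1 v) by exact: frame_elt.
    apply: run_if => // {}h.
      have hlt : digits s k.+1 + 1 < t.
        rewrite -q2 -e4 -[reg s 4]a1 //; change (digits s2 k.+1 + 1 < reg s2 4).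
        by move: h; rewrite [den _ _]/(nat_of_bool (digits s2 k.+1 + 1 < reg s2 4)); case: ltnP.
      apply: run_seq; apply: run_store_arr => //.
        by move=> _; change (digits s2 k.+1 + 1 <= M); rewrite q2; lia.
      apply: run_assign => //; split.
      - by apply: frame_reg => //; exact: frame_elt.
      - move=> i hi; change (digits (set_elt s2 21 k.+1 (digits s2 k.+1 + 1)) i < t).
        by rewrite Eset; case: eqP => _; [rewrite q2|exact: d1].
      - move=> i hi; change (digits (set_elt s2 21 k.+1 (digits s2 k.+1 + 1)) i = digits s i).
        by rewrite Eset ifF; [apply: q1|]; lia.
      - right; split=> //; set s3 := set_reg _ _ _.
        change ((odo_val t (digits s) k).+1 + digits s k.+1 * t ^ k =
          odo_val t (digits s3) k + digits s3 k.+1 * t ^ k).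
        rewrite hv (ext s3); last by move=> i ne; rewrite -[LHS]/(digits (set_elt s2 21 k.+1 _) i) Eset (negPf ne).
        have -> : digits s3 k.+1 = digits s k.+1 + 1.
          by rewrite -[LHS]/(digits (set_elt s2 21 k.+1 (digits s2 k.+1 + 1)) k.+1) Eset eqxx q2.
        by rewrite mulnDl; lia.
    have heq : digits s k.+1 + 1 = t.
      have : ~~ (digits s2 k.+1 + 1 < reg s2 4).
        by move: h; rewrite [den _ _]/(nat_of_bool (digits s2 k.+1 + 1 < reg s2 4)); case: ltnP.
      by rewrite q2 -[reg s2 4]/(reg s1 4) a1 // e4; lia.
    apply: run_store_arr => //.
    change (I k.+1 (set_elt s2 21 k.+1 0)); split=> //.
    - by move=> i hi; rewrite Eset; case: eqP => _; [lia|exact: d1].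
    - by move=> i hi; rewrite Eset ifF; [apply: q1|]; lia.
    - left; split=> //.
      set s3 := set_elt s2 21 k.+1 0.
      change ((odo_val t (digits s) k).+1 + digits s k.+1 * t ^ k =
        odo_val t (digits s3) k + digits s3 k.+1 * t ^ k + t ^ k.+1).
      rewrite hv (ext s3); last by move=> i ne; rewrite Eset (negPf ne).
      (* The digit was [t - 1] and becomes 0, which moves the carry up one place. *)
      have -> : t ^ k.+1 = digits s k.+1 * t ^ k + t ^ k by rewrite expnS -{1}heq mulnDl mul1n.
      by rewrite Eset eqxx mul0n; lia.
  move=> s1 [_ [f1 d1 _ hc]]; apply: run_assign => //.
    by move=> _; change (1 - reg s1 14 <= M); lia.
  split; [exact: frame_reg|exact: d1|].
  case: hc => [[h14 hv]|[h14 hv]]; [right|left]; split; rewrite ?hv /= ?/upd /= ?h14 //.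
  exact: leq_addl.
- suff: 2 + (l * (tcost carry_step + 8) + 6 + 4) <= l * incr_const by [].
  have : 1 * 20 <= l * 20 by rewrite leq_mul2r l_gt0.
  by rewrite /incr_const !mulnDr; lia.
Qed.

Definition search :=
  Seq (Assign 13 (Const 1))
      (While (Reg 13)
         (Seq solve
            (If (Reg 9) (Seq (Assign 0 (Const 1)) (Assign 13 (Const 0))) incr))).

Definition search_const := solve_const + incr_const + 40.

Lemma solution_ext G G' f : (forall i, 0 < i <= l -> G i = G' i) -> sol G f -> sol G' f.
Proof. by move=> E h i hi; have [a b c] := h i hi; split=> //; rewrite -E. Qed.

(** The budget is [t ^ l] minus the value of the odometer, and all assignments of smaller value are
    known to fail. *)
Lemma search_run s : ready s -> reg s 0 = 0 -> (forall i, 0 < i <= l -> digits s i = 0) ->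
  run search s (t ^ l * (l * (n * (l * n * search_const))))
    (fun s' => (reg s' 0 = 1 /\ subpattern sigma pi) \/
               (reg s' 0 = 0 /\ ~ subpattern sigma pi)).
Proof.
move=> hr h0 hz.
(* Point 1 of [pi] belongs to some class. *)
have t_gt0 : 0 < t.
  by have [j _] := class_ofP redp mp (n_gt0 : 0 < 1 <= n); apply: leq_ltn_trans (ltn_ord j).
pose I m s' := [/\ ready s', (forall i, 0 < i <= l -> digits s' i < t) &
  [/\ reg s' 13 = 1, reg s' 0 = 0, m + odo_val t (digits s') l = t ^ l &
      forall G f, (forall i, 0 < i <= l -> G i < t) ->
        odo_val t G l < odo_val t (digits s') l -> ~ sol G f] \/
  (reg s' 13 = 0 /\ ((reg s' 0 = 1 /\ subpattern sigma pi) \/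
                     (reg s' 0 = 0 /\ ~ subpattern sigma pi)))].
have v0 : odo_val t (digits s) l = 0.
  rewrite (@odo_val_ext _ _ (fun=> 0) _ hz).
  by elim: (l) => //= k ->.
eapply run_leT.
- apply: run_seq; apply: run_assign => //.
  apply: (@run_while (Reg 13) _ I _ (t ^ l)) => //.
  + split=> //; first by move=> i hi; rewrite [digits _ _]hz.
    left; split=> //; first by rewrite [odo_val _ _ _]v0 addn0.
    by move=> G f _; rewrite [odo_val _ (digits _) _]v0.
  + move=> m s1 [hr1 hd1 hI] h13.
    case: hI => [[g13 g0 gm gn]|[g13 _]]; last by rewrite /= g13 in h13.
    have vlt : odo_val t (digits s1) l < t ^ l by exact: odo_val_lt.
    apply: run_seq; eapply run_le; [|exact: leqnn|].
      by apply: (@solve_run (digits s1)).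
    move=> s2 [f2 hs]; have [a2 _ b2] := f2.
    have hr2 : ready s2 by exact: ready_frame f2 _ _ hr1.
    have d2 i : digits s2 i = digits s1 i by exact: b2.
    have d2' i : 0 < i <= l -> digits s2 i < t by rewrite d2; exact: hd1.
    apply: run_if => // h9.
      case: hs => [[_ [f hf]]|[h9' _]]; last by [].
      apply: run_seq; apply: run_assign => //; apply: run_assign => //.
      exists 0; first by lia.
      split=> //; right; split=> //; left; split=> //.
      exact: (solution_subpattern reds redp hf).
    case: hs => [[h9' _]|[_ hno]]; first by rewrite /= h9' in h9.
    have ev : odo_val t (digits s2) l = odo_val t (digits s1) l by exact: odo_val_ext.
    eapply run_le; [exact: (incr_run hr2 d2')|exact: leqnn|].
    move=> s3 [f3 d3 hc]; have [a3 _ _] := f3.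
    have r0 : reg s3 0 = 0 by rewrite a3 // a2.
    have gn' G f : (forall i, 0 < i <= l -> G i < t) ->
        odo_val t G l < (odo_val t (digits s1) l).+1 -> ~ sol G f.
      move=> hG; rewrite ltnS leq_eqVlt => /orP [/eqP E|]; last exact: gn.
      move=> hf; apply: (hno f); apply: solution_ext hf.
      exact: odo_val_inj E.
    rewrite ev in hc.
    exists m.-1; first by lia.
    split=> //; first by exact: ready_frame f3 _ _ hr2.
    case: hc => [[h13' hv]|[h13' hv]]; [left|right].
      by split=> //; [lia|move=> G f hG; rewrite -hv; exact: gn'].
    (* The odometer has overflowed: every assignment has value below [t ^ l] and has been
       refuted. *)
    split=> //; right; split=> // /(subpattern_solution reds redp mp) [G [hG [f hf]]].
    by apply: (gn' G f hG _ hf); apply: leq_trans hv; exact: odo_val_lt.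
  by move=> m s1 [_ _ [[h13 _ _ _]|[_ //]]]; rewrite /= h13.
- suff: 2 + (2 + t ^ l * (1 + (l * (n * (l * n * solve_const)) +
     (1 + maxn 4 (l * incr_const)).+1)).+1) <= t ^ l * (l * (n * (l * n * search_const))) by [].
  have tl : 0 < t ^ l by rewrite expn_gt0 t_gt0.
  have x1 x : x <= l * (n * (l * n * x)) by rewrite !mulnA leq_pmull // !muln_gt0 l_gt0 n_gt0.
  have x2 x : l * x <= l * (n * (l * n * x)).
    by rewrite leq_mul2l !mulnA leq_pmull ?orbT // !muln_gt0 l_gt0 n_gt0.
  have h : (1 + (l * (n * (l * n * solve_const)) + (1 + maxn 4 (l * incr_const)).+1)).+1 + 4
      <= l * (n * (l * n * search_const)).
    move: (x1 1) (x2 incr_const); rewrite /search_const !(mulnDr (l * n)) !(mulnDr n) !(mulnDr l).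
    by lia.
  have h' : t ^ l * ((1 + (l * (n * (l * n * solve_const)) +
      (1 + maxn 4 (l * incr_const)).+1)).+1 + 4) <= t ^ l * (l * (n * (l * n * search_const))).
    by rewrite leq_mul2l h orbT.
  by move: h'; rewrite mulnDr; lia.
Qed.

(** * Tables computed from the input *)

Definition tableC off sz j :=
  each (fun d => Store (arr (j + d) (crdE off sz d (Reg 5))) (Reg 5)).

(** The inverse is filled in one pass by writing [i] at each of its coordinates. Cells never reached
    keep their initial 0, the default value of [crd_inv]; cell 0 is one of them. *)
Lemma table_run p off o sz j s : reduced p -> reg s sz = len p -> points_at s o p ->
  (forall s', (forall r, r != 5 -> reg s' r = reg s r) -> den s' off = o) ->
  (forall d b, d < 4 -> elt s (j + d) b = 0) ->
  j + 3 < 32 -> 5 != sz -> framed (tableC off sz j) ->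
  (forall d, d < 4 -> light (arr (j + d) (crdE off sz d (Reg 5)))) ->
  run (For 5 sz (tableC off sz j)) s (len p * (tcost (tableC off sz j) + 8) + 6)
    (fun s' => frame [:: 5] (iota j 4) s s' /\
       forall d b, d < 4 -> elt s' (j + d) b = crd_inv p d b).
Proof.
move=> red hsz hpt hoff hz hj h5 hfr hnb.
pose I k s' := frame [:: 5] (iota j 4) s s' /\ forall d b, d < 4 ->
  elt s' (j + d) b = if crd_inv p d b <= k then crd_inv p d b else 0.
apply: run_bounded => hb.
have hM : len p <= M by rewrite -hsz; exact: (proj1 hb).
have inv_le d b : d < 4 -> crd_inv p d b <= len p.
  move=> hd; have [h|h] := boolP (0 < b <= len p).
    by have := crd_inv_range red hd h; lia.
  by rewrite crd_inv_out.
eapply run_le; [|exact: leqnn|].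
  apply: (@run_for 5 sz _ I (len p)) => //.
    split; first exact: frame_reg.
    move=> d b hd; rewrite -[LHS]/(elt s (j + d) b) hz // leqn0.
    by case: eqP => // ->.
  move=> k s1 hk [f1 h1] r5 rsz.
  have f2 : frame [:: 5] (iota j 4) s (set_reg s1 5 k.+1) by exact: frame_reg.
  apply: (@run_each _ j _ (fun=> Reg 5) (fun d => crd p d k.+1) (fun=> k.+1)) => //.
  - by move=> d hd; rewrite hnb.
  - by move=> _ d hd; lia.
  - move=> d s3 hd f3; have [a3 _ _] := f3.
    have f3' : frame [:: 5] (iota j 4) s s3.
      by apply: (frame_trans _ f2) => //; apply: frame_sub f3.
    have r5' : reg s3 5 = k.+1 by rewrite a3.
    split=> //; rewrite (@den_crdE _ _ _ p) /= ?r5' //.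
      rewrite hoff; first exact: points_at_frame f3' hpt.
      by move=> r hr; have [-> //] := f3'; rewrite inE.
    by have [-> //] := f3'; rewrite inE eq_sym.
  split.
    by apply: (frame_trans _ f2) => //; apply: frame_sub (frame_set4 _ _ _ _).
  move=> d b hd; rewrite elt_set4 //; last by lia.
  rewrite addKn; have [->|ne] := eqVneq b (crd p d k.+1).
    by rewrite ifT ?crdK ?leqnn //; lia.
  rewrite ifF; last by lia.
  rewrite -[LHS]/(elt s1 (j + d) b) h1 //.
  have nek : crd_inv p d b != k.+1.
    apply: contraNneq ne => E; apply/eqP; rewrite -E crd_invK //.
    by apply: contraT => hout; move: E; rewrite crd_inv_out.
  by rewrite [in RHS]leq_eqVlt (negPf nek) ltnS.
move=> s' [_ [f h]]; split=> // d b hd.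
by rewrite h // inv_le.
Qed.

Definition predC := each (fun d =>
  Store (arr (8 + d) (Reg 5)) (ld (4 + d) (Op Defs.Sub (crdE offS 2 d (Reg 5)) (Const 1)))).

Lemma pred_run s : reg s 2 = l -> points_at s 1 sigma ->
  (forall d b, d < 4 -> elt s (4 + d) b = crd_inv sigma d b) ->
  run (For 5 2 predC) s (l * (tcost predC + 8) + 6)
    (fun s' => frame [:: 5] [:: 8; 9; 10; 11] s s' /\
       forall d i, d < 4 -> 0 < i <= l -> elt s' (8 + d) i = pred_in sigma d i).
Proof.
move=> e2 hpt hS; have lM := l_le_M.
pose I k s' := frame [:: 5] [:: 8; 9; 10; 11] s s' /\ forall d i, d < 4 ->
  0 < i <= k -> elt s' (8 + d) i = pred_in sigma d i.
eapply run_le; [|exact: leqnn|].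
  apply: (@run_for 5 2 _ I l) => //.
    by split; [exact: frame_reg|move=> d i _; lia].
  move=> k s1 hk [f1 h1] r5 r2.
  have f2 : frame [:: 5] [:: 8; 9; 10; 11] s (set_reg s1 5 k.+1) by exact: frame_reg.
  apply: (@run_each _ 8 (fun=> Reg 5) _ (fun=> k.+1) (fun d => pred_in sigma d k.+1)) => //.
  - by case=> [|[|[|[|]]]].
  - by move=> _ d hd; have := pred_in_range reds hd (hk : 0 < k.+1 <= l); lia.
  - move=> d s3 hd f3; have [a3 _ _] := f3.
    have f3' : frame [:: 5] [:: 8; 9; 10; 11] s s3.
      by apply: (frame_trans _ f2) => //; apply: frame_sub f3.
    have r5' : reg s3 5 = k.+1 by rewrite a3.
    have [a3' _ c3] := f3'.
    have hcr : den s3 (crdE offS 2 d (Reg 5)) = crd sigma d k.+1.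
      rewrite (@den_crdE _ _ _ sigma) /= ?r5' //; last by rewrite a3'.
      exact: points_at_frame f3' hpt.
    split=> //.
    rewrite -[den _ _]/(elt s3 (4 + d) (den s3 (crdE offS 2 d (Reg 5)) - 1)) hcr subn1.
    rewrite c3; [exact: hS|lia|by rewrite !inE; lia].
  split.
    apply: (frame_trans _ f2) => //; apply: frame_sub (frame_set4 _ _ _ _) => // x.
  move=> d i hd hi; rewrite elt_set4 //; last by lia.
  rewrite addKn; case: eqP => [->|ne]; first by rewrite ifT //; lia.
  by rewrite ifF; [apply: h1 => //|]; lia.
by move=> s' [_ h].
Qed.

(** Register 17 counts the classes from 1, one ahead of their indices. *)
Definition class_step :=
  Seq (Store (arr 20 (Fetch (Reg 15))) (Op Defs.Sub (Reg 17) (Const 1)))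
      (Assign 15 (Op Add (Reg 15) (Const 1))).

Definition classC :=
  Seq (Assign 15 (Op Add (Const 3) (Op Add (Op Mul (Const 2) (Reg 2)) (Op Mul (Const 2) (Reg 3)))))
      (For 17 4
        (Seq (Assign 16 (Fetch (Reg 15)))
        (Seq (Assign 15 (Op Add (Reg 15) (Const 1)))
             (For 5 16 class_step)))).

Notation inp := (encode sigma pi Pi).
Notation class_at k := (nth fset0 (tval Pi) k).

Definition class_regs := [:: 5; 15; 16; 17].

Lemma class_pos_mono k k' : k <= k' <= t -> class_pos Pi k <= class_pos Pi k'.
Proof.
move=> /andP [hk]; elim: k' hk => [|k' IH]; first by rewrite leqn0 => /eqP ->.
rewrite leq_eqVlt => /orP [/eqP -> //|hk] ht.
by rewrite (class_posS Pi ht); apply: (leq_trans (IH _ (ltnW ht))) => //; lia.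
Qed.

Lemma class_run s : reg s 2 = l -> reg s 3 = n -> reg s 4 = t ->
  (forall a, a < size inp -> cell s a = nth 0 inp a) -> size inp <= reg s 1 ->
  run classC s (10 + (t * (n * (tcost class_step + 8) + 30) + 6))
    (fun s' => frame class_regs [:: 20] s s' /\
       forall q, 0 < q <= n -> elt s' 20 q = class_of Pi q).
Proof.
move=> e2 e3 e4 hin hsz; apply: run_bounded => hb.
have HM : size inp <= M by apply: leq_trans hsz (proj1 hb 1).
have hse := size_encode sigma pi Pi.
set base := 3 + 2 * l + 2 * n.
pose I k s' := [/\ frame class_regs [:: 20] s s',
  reg s' 15 = base + class_pos Pi k &
  forall i q, i < k -> q \in class_at i -> elt s' 20 q = i].
eapply run_le; [|exact: leqnn|].
- apply: run_seq; apply: run_assign => //.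
    move=> _; change (3 + (2 * reg s 2 + 2 * reg s 3) <= M); lia.
  eapply run_leT.
  + apply: (@run_for 17 4 _ I t) => //.
      split=> //; first by apply: frame_reg => //; exact: frame_reg.
      rewrite /class_pos take0 addn0; change (3 + (2 * reg s 2 + 2 * reg s 3) = base).
      by rewrite e2 e3 addnA.
    move=> k s1 hk [f1 p1 h1] r17 r4; have [a1 b1 _] := f1.
    have hpS := class_posS Pi hk.
    have hpt : class_pos Pi k.+1 <= class_pos Pi t by apply: class_pos_mono; lia.
    have hcell j : j <= #|` class_at k| ->
        cell s1 (base + class_pos Pi k + j) = nth 0 (encode_class (class_at k)) j.
      move=> hj; rewrite b1; last by rewrite /base; lia.
      rewrite hin; last by rewrite hse /base; lia.
      exact: nth_encode_class.
    have fk : frame class_regs [:: 20] s (set_reg s1 17 k.+1) by exact: frame_reg.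
    have hd1 : den (set_reg s1 17 k.+1) (Fetch (Reg 15)) = #|` class_at k|.
      change (cell s1 (reg s1 15) = #|` class_at k|).
      by rewrite p1 -[base + _]addn0 hcell.
    apply: run_seq; apply: run_assign => //; first by move=> [_ h]; exact: h.
    rewrite hd1; apply: run_seq; apply: run_assign => //.
      by move=> _; change (reg s1 15 + 1 <= M); rewrite p1 /base; lia.
    set s2 := set_reg _ 15 _.
    have p2 : reg s2 15 = base + class_pos Pi k + 1 by rewrite -p1.
    have f2 : frame class_regs [:: 20] s s2 by do 2 apply: frame_reg => //.
    have hcard := card_class_at redp mp hk.
    pose J j s' := [/\ frame class_regs [:: 20] s s',
      reg s' 15 = base + class_pos Pi k + 1 + j, reg s' 17 = k.+1,
      forall i q, i < k -> q \in class_at i -> elt s' 20 q = i &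
      forall j', j' < j -> elt s' 20 (nth 0 (encode_class (class_at k)) j'.+1) = k].
    (* Each class is charged as if it had [n] points, for a uniform cost per iteration of the outer
       loop. *)
    eapply run_le with (T := n * (tcost class_step + 8) + 6); [|exact: leqnn|].
      eapply run_leT.
        apply: (@run_for 5 16 _ J #|` class_at k|) => //.
          by split=> //; [exact: frame_reg|rewrite addn0].
        move=> j s3 hj [f3 p3 q3 o3 n3] r5 r16.
        have [a3 b3 _] := f3.
        have hd : den (set_reg s3 5 j.+1) (Fetch (Reg 15)) =
            nth 0 (encode_class (class_at k)) j.+1.
          change (cell s3 (reg s3 15) = nth 0 (encode_class (class_at k)) j.+1).
          rewrite -hcell; last by lia.
          rewrite p3 -addnA add1n b3 ?b1 //; rewrite /base; lia.
        set x := nth 0 (encode_class (class_at k)) j.+1 in hd *.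
        have hx : x \in class_at k by exact: nth_class_mem.
        apply: run_seq; apply: run_store_arr => //.
          by move=> _; change (reg s3 17 - 1 <= M); rewrite q3; lia.
        rewrite hd; set s4 := set_elt _ _ _ _.
        have E4 q : elt s4 20 q = if q == x then k else elt s3 20 q.
          rewrite elt_set_elt // eqxx andTb; case: eqP => // _.
          by change (reg s3 17 - 1 = k); rewrite q3 subn1.
        have f4 : frame class_regs [:: 20] s s4.
          by apply: frame_elt => //; exact: frame_reg.
        apply: run_assign => //.
          by move=> _; change (reg s3 15 + 1 <= M); rewrite p3 /base; lia.
        split=> //.
        - exact: frame_reg.
        - by change (reg s3 15 + 1 = base + class_pos Pi k + 1 + j.+1); rewrite p3; lia.
        - move=> i q hi hq; change (elt s4 20 q = i); rewrite E4.
          case: eqP => [E|_]; last exact: o3.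
          (* A point of class [k] also lying in an earlier class would have two values of
             [class_of]. *)
          have hit : i < t by lia.
          have := class_at_of mp hit hq; have := class_at_of mp hk hx.
          by rewrite E => -> ; lia.
        - move=> j' hj'; change (elt s4 20 (nth 0 (encode_class (class_at k)) j'.+1) = k).
          rewrite E4; case: eqP => // ne; apply: n3.
          have [Ej|?] := eqVneq j' j; last by lia.
          by case: ne; rewrite Ej.
      by rewrite leq_add2r leq_mul2r hcard orbT.
    move=> s3 [_ [f3 p3 q3 o3 n3]]; split=> //; first by rewrite p3 hpS; lia.
    move=> i q hi hq; have [ik|ik] := eqVneq i k; last by apply: o3 => //; lia.
    move: hq; rewrite ik => /class_mem_nth [j hj <-]; exact: n3.
  rewrite leq_add2r leq_mul2l; apply/orP; right.
  by change (3 + (4 + (n * (tcost class_step + 8) + 6)) + 8 <= n * (tcost class_step + 8) + 30); lia.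
move=> s' [_ [f p h]]; split=> // q hq.
have [i [E hi]] := class_ofP redp mp hq; rewrite E; apply: h => //.
by rewrite -(tnth_nth fset0 Pi i).
Qed.

Definition prep :=
  Seq (For 5 3 (tableC offP 3 0))
 (Seq (For 5 2 (tableC offS 2 4))
 (Seq (For 5 2 predC) classC)).

Definition prep_const := tcost (tableC offP 3 0) + tcost (tableC offS 2 4) +
  tcost predC + tcost class_step + 100.

Definition prep_arrs := [:: 0; 1; 2; 3; 4; 5; 6; 7; 8; 9; 10; 11; 20].

Lemma prep_run s : reg s 2 = l -> reg s 3 = n -> reg s 4 = t ->
  (forall a, a < size inp -> cell s a = nth 0 inp a) ->
  3 + 2 * l + 2 * n <= size inp <= reg s 1 ->
  (forall j i, j < 32 -> elt s j i = 0) ->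
  run prep s ((n + l + l + t * n + t + 1) * prep_const)
    (fun s' => frame class_regs prep_arrs s s' /\ ready s').
Proof.
move=> e2 e3 e4 hin hsz hz.
have pS : points_at s 1 sigma.
  split=> [|i hi]; first by lia.
  have [h1 h2] := nth_encode_sigma pi Pi hi.
  by rewrite !hin ?h1 ?h2 //; lia.
have pP : points_at s (1 + 2 * l) pi.
  split=> [|i hi]; first by lia.
  have [h1 h2] := nth_encode_pi sigma Pi hi.
  by rewrite !hin ?h1 ?h2 //; lia.
eapply run_leT.
- apply: run_seq; eapply run_le; [|exact: leqnn|].
    apply: (@table_run pi offP (1 + 2 * l) 3 0 s) => //.
    + by move=> s' hs; rewrite /= hs // e2.
    + by move=> d b hd; apply: hz; lia.
    + by case=> [|[|[|[|]]]].
  move=> s1 [f1 t1]; have [a1 b1 c1] := f1.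
  apply: run_seq; eapply run_le; [|exact: leqnn|].
    apply: (@table_run sigma offS 1 2 4 s1) => //.
    + by rewrite a1.
    + exact: points_at_frame f1 pS.
    + by move=> d b hd; rewrite c1 ?hz ?mem_iota //; lia.
    + by case=> [|[|[|[|]]]].
  move=> s2 [f2 t2].
  have f12 : frame [:: 5] prep_arrs s s2.
    apply: (@frame_trans _ _ s s1) => //; [apply: frame_sub f1|apply: frame_sub f2] => //; exact/allP.
  have [a2 b2 c2] := f12.
  apply: run_seq; eapply run_le; [|exact: leqnn|].
    apply: (@pred_run s2) => //; first by rewrite a2.
    exact: points_at_frame f12 pS.
  move=> s3 [f3 t3].
  have f13 : frame [:: 5] prep_arrs s s3.
    by apply: (frame_trans _ f12) => //; apply: frame_sub f3 => //; exact/allP.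
  have [a3 b3 c3] := f13.
  eapply run_le; [|exact: leqnn|].
    apply: (@class_run s3); rewrite ?a3 //.
      by move=> a ha; rewrite b3 ?hin //; lia.
    by case/andP: hsz.
  move=> s4 [f4 t4].
  have f14 : frame class_regs prep_arrs s s4.
    apply: (@frame_trans _ _ s s3) => //.
      by apply: frame_sub f13 => //; exact/allP.
    by apply: frame_sub f4 => //; exact/allP.
  split=> //; have [a4 _ _] := f14; have [_ _ g2] := f2; have [_ _ g3] := f3; have [_ _ g4] := f4.
  split=> //.
  + by rewrite !a4.
  + exact: points_at_frame f14 pS.
  + exact: points_at_frame f14 pP.
  + move=> d hd; split=> [b hb|i hi].
      rewrite g4; [|lia|by clear -hd; case: d hd => [|[|[|[|]]]]].
      rewrite g3; [|lia|by clear -hd; case: d hd => [|[|[|[|]]]]].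
      rewrite g2; [exact: t1|lia|by clear -hd; case: d hd => [|[|[|[|]]]]].
    rewrite g4; [exact: t3|lia|by clear -hd; case: d hd => [|[|[|[|]]]]].
- suff: n * (tcost (tableC offP 3 0) + 8) + 6 + (l * (tcost (tableC offS 2 4) + 8) + 6 +
    (l * (tcost predC + 8) + 6 + (10 + (t * (n * (tcost class_step + 8) + 30) + 6)))) <=
    (n + l + l + t * n + t + 1) * prep_const by [].
  rewrite /prep_const; move: (tcost _) (tcost _) (tcost _) (tcost _) => a b c d.
  by rewrite !(mulnDr, mulnDl) !mulnA; lia.
Qed.

(** * Assembly of the program and final bounds *)

(* [t * n] is a bound on the total size of the classes. *)
Definition array_base :=
  Op Add (Op Add (Const 3) (Op Add (Op Mul (Const 2) (Reg 2)) (Op Add (Op Mul (Const 2) (Reg 3)) (Reg 4))))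
         (Op Mul (Reg 4) (Reg 3)).

Definition main := Seq (Assign 1 array_base) (Seq prep search).

(** The factor 6 counts the summands of the preprocessing bound, each at most
    [t ^ l * l ^ 2 * n ^ 2]. *)
Definition main_const := 6 * prep_const + search_const + 30.

(** A product of two registers is not light, so this assignment is checked from a direct bound on
    its value. *)
Lemma run_assign_base s (Q : state -> Prop) :
  den s array_base <= M -> Q (set_reg s 1 (den s array_base)) ->
  run (Assign 1 array_base) s (cost array_base).+1 Q.
Proof.
move=> hM hQ hb; exists (cost array_base).+1, (set_reg s 1 (den s array_base)).
split=> //; last exact: bounded_reg.
apply: ExecAssign; rewrite /array_base; set e := Op Add (Const 3) _.
have he : den s array_base = den s e + reg s 4 * reg s 3 by [].
have small v : v <= M -> guard_lt W v = Some v by move=> hv; rewrite /guard_lt ifT //; lia.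
have bin o e1 e2 : eval W W s e1 = Some (den s e1) -> eval W W s e2 = Some (den s e2) ->
    den s (Op o e1 e2) <= M -> eval W W s (Op o e1 e2) = Some (den s (Op o e1 e2)).
  by move=> h1 h2 h; rewrite [LHS]/= h1 /= h2; exact: small.
apply: (bin _ _ _) => //; first exact: eval_den.
apply: (bin _ _ _); [exact: eval_den|exact: eval_den|].
by apply: leq_trans hM; rewrite he; exact: leq_addl.
Qed.

Lemma main_run s : reg s 0 = 0 -> reg s 2 = l -> reg s 3 = n -> reg s 4 = t ->
  (forall a, cell s a = nth 0 inp a) -> 3 + 2 * l + 2 * n + t + t * n <= M ->
  run main s (t ^ l * l ^ 2 * n ^ 2 * main_const)
    (fun s' => (reg s' 0 = 1 /\ subpattern sigma pi) \/
               (reg s' 0 = 0 /\ ~ subpattern sigma pi)).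
Proof.
move=> h0 e2 e3 e4 hin hM.
have t_gt0 : 0 < t.
  by have [j _] := class_ofP redp mp (n_gt0 : 0 < 1 <= n); apply: leq_ltn_trans (ltn_ord j).
have hden : den s array_base = 3 + 2 * l + 2 * n + t + t * n.
  by rewrite /= e2 e3 e4; lia.
have hse := size_encode sigma pi Pi; have hle := class_pos_le redp mp.
eapply run_leT.
- apply: run_seq; apply: run_assign_base; rewrite hden //.
  set s1 := set_reg _ _ _.
  (* The arrays start beyond the input, where the initial memory reads 0. *)
  have z1 j i : j < 32 -> elt s1 j i = 0.
    move=> hj; rewrite /elt [cell _ _]hin nth_default //.
    change (size inp <= 3 + 2 * l + 2 * n + t + t * n + 32 * i + j).
    by move: hle; rewrite mulnS; lia.
  apply: run_seq; eapply run_le; [|exact: leqnn|].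
    apply: (@prep_run s1) => //; first by move=> a _; exact: hin.
    by change (3 + 2 * l + 2 * n <= size inp <= 3 + 2 * l + 2 * n + t + t * n);
      move: hle; rewrite mulnS; lia.
  move=> s2 [[a2 b2 c2] hr2].
  apply: search_run => //; first by rewrite a2.
  by move=> i hi; rewrite /digits c2 ?z1.
- suff: (cost array_base).+1 + ((n + l + l + t * n + t + 1) * prep_const +
    t ^ l * (l * (n * (l * n * search_const)))) <= t ^ l * l ^ 2 * n ^ 2 * main_const by [].
  (* Since [l] is positive, the [t * n] steps spent on reading the classes fit in the bound. *)
  have tl : t <= t ^ l by rewrite -[X in X <= _]expn1 leq_pexp2l.
  have -> : t ^ l * (l * (n * (l * n * search_const))) = t ^ l * l ^ 2 * n ^ 2 * search_const.
    by rewrite -!mulnn !mulnA; lia.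
  set X := t ^ l * l ^ 2 * n ^ 2.
  have tlX y z : y <= t ^ l -> z <= l ^ 2 * n ^ 2 -> y * z <= X.
    by move=> hy hz; rewrite /X -mulnA leq_mul.
  have n2 : n <= n ^ 2 by rewrite -mulnn leq_pmulr.
  have l2 : l <= l ^ 2 by rewrite -mulnn leq_pmulr.
  have l2' : 0 < l ^ 2 by rewrite expn_gt0 l_gt0.
  have n2' : 0 < n ^ 2 by rewrite expn_gt0 n_gt0.
  have nX : n <= l ^ 2 * n ^ 2 by apply: leq_trans n2 _; exact: leq_pmull.
  have lX : l <= l ^ 2 * n ^ 2 by apply: leq_trans l2 _; exact: leq_pmulr.
  have X1 : 1 <= l ^ 2 * n ^ 2 by rewrite muln_gt0 l2'.
  have tl1 : 1 <= t ^ l by rewrite expn_gt0 t_gt0.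
  have b1 : n <= X by rewrite -[n]mul1n; exact: tlX.
  have b2 : l <= X by rewrite -[l]mul1n; exact: tlX.
  have b3 : t * n <= X by exact: tlX.
  have b4 : t <= X by rewrite -[t]muln1; exact: tlX.
  have b5 : 1 <= X by rewrite -[1]muln1; exact: tlX.
  have h : (n + l + l + t * n + t + 1) * prep_const <= 6 * X * prep_const.
    by rewrite leq_mul2r; apply/orP; right; lia.
  have hc : (cost array_base).+1 <= 30 by [].
  by rewrite /main_const; lia.
Qed.

End Program.
End Run.

(** Empty permutations are settled apart: an empty [sigma] always embeds, and a nonempty one never
    embeds in an empty [pi], where register 0 keeps its initial 0. *)
Definition prog :=
  Seq (Assign 2 (Fetch (Const 0)))
 (Seq (Assign 3 (Fetch (Const 1)))
 (Seq (Assign 4 (Fetch (Const 2)))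
      (If (Reg 2) (If (Reg 3) main Skip) (Assign 0 (Const 1))))).

(** Polynomial space is expressed by the bound [N ^ k] on both the number of cells and the words.
    The [+ 1] in the time pays for instances with [l] or [n] zero, where the product vanishes. *)
Theorem theorem7 :
  exists (prog : cmd) (c k : nat),
  forall (t : nat) (sigma pi : lpoints) (Pi : t.-tuple {fset nat}),
    reduced sigma -> reduced pi -> monotone_partition pi Pi ->
    let l := len sigma in
    let n := len pi in
    let N := size (encode sigma pi Pi) in
    exists (T : nat) (b : bool),
      [/\ answers (N ^ k) (N ^ k) prog (encode sigma pi Pi) T b,
          b <-> subpattern sigma pi &
          T <= c * (t ^ l * l ^ 2 * n ^ 2 + 1)].
Proof.
exists prog, (main_const + 30), 8 => t sigma pi Pi rs rp mp l n N.
have hN : N = 3 + 2 * l + 2 * n + class_pos Pi t := size_encode sigma pi Pi.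
have ht := class_pos_ge Pi.
have N3 : 3 <= N by lia.
have hNN : 3 * N <= N * N by rewrite leq_mul2r N3 orbT.
have hNNN : 3 * (N * N) <= N * (N * N) by rewrite leq_mul2r N3 orbT.
(* All stored values are at most [N ^ 3]. As [N] is at least 3, [N ^ 5] is at least 243 and exceeds
   the factor 200, whence the exponent 8. *)
set M := N * (N * N).
have M_gt0 : 0 < M by rewrite !muln_gt0; lia.
have MW : 200 * M < N ^ 8.
  have -> : N ^ 8 = N ^ 5 * M by rewrite /M -[8]/(5 + 3) expnD !expnS expn0 muln1.
  rewrite ltn_mul2r M_gt0 /=; apply: (@leq_trans (3 ^ 5)) => //.
  by rewrite leq_exp2r.
set s0 := init (encode sigma pi Pi).
have hb : bounded M s0.
  split=> // a; apply: leq_trans (nth_encode_le rs rp mp a) _.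
  by rewrite -/N /M; lia.
have [i0 i1 i2] := nth_encode_head sigma pi Pi.
suff : run (N ^ 8) M prog s0 (t ^ l * l ^ 2 * n ^ 2 * main_const + 30)
    (fun s' => (reg s' 0 = 1 /\ subpattern sigma pi) \/
               (reg s' 0 = 0 /\ ~ subpattern sigma pi)).
  case/(_ hb) => T [s' [ex le _ hres]].
  exists T, (reg s' 0 == 1); split; first 1 last.
  - by case: hres => [[-> ?]|[-> ?]].
  - by apply: leq_trans le _; move: main_const => K; rewrite mulnDl !mulnDr; lia.
  - by exists s' => //; case: hres => [[-> _]|[-> _]].
eapply run_leT.
- do 3 (apply: run_seq; apply: (run_assign M_gt0 MW) => //; first by move=> [_ h]; exact: h).
  set s1 := set_reg _ _ _.
  have e2 : reg s1 2 = l by exact: i0.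
  have e3 : reg s1 3 = n by exact: i1.
  have e4 : reg s1 4 = t by exact: i2.
  apply: (run_if M_gt0 MW) => // h2; last first.
    have {}h2 : l = 0 by exact: etrans (esym e2) h2.
    apply: (run_assign M_gt0 MW) => //; left; split=> //.
    exists id; split=> [p|a p p']; rewrite mem_supp // -/l h2; first by lia.
    by move=> hp; lia.
  have l_gt0 : 0 < l by rewrite lt0n; apply/eqP => h; apply: h2; exact: etrans e2 h.
  apply: (run_if M_gt0 MW) => // h3; last first.
    have {}h3 : n = 0 by exact: etrans (esym e3) h3.
    apply: run_skip; right; split=> // -[phi [h _]].
    have := h 1; rewrite !mem_supp // -/n -/l l_gt0 h3 => /(_ isT); lia.
  have n_gt0 : 0 < n by rewrite lt0n; apply/eqP => h; apply: h3; exact: etrans e3 h.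
  have hln : 2 * l * (2 * n) <= N * N by apply: leq_mul; lia.
  have htn : t * n <= N * N by apply: leq_mul; lia.
  have hbig : 9 * l * n + t + n < M by rewrite /M; lia.
  apply: (main_run M_gt0 MW rs rp l_gt0 n_gt0 hbig mp) => //.
  by rewrite /M; lia.
- change (3 + (3 + (3 + (1 + maxn (1 + maxn (t ^ l * l ^ 2 * n ^ 2 * main_const) 1).+1 2).+1)) <=
    t ^ l * l ^ 2 * n ^ 2 * main_const + 30).
  by move: (_ * main_const) => x; lia.
Qed.
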